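(* Let $k\ge 1$ and let $T$ be one of the four standard Young tableaux of size $3$. Then \[ s_{\mathsf{shape}(T)}[s_k]=\sum_{\substack{S\in\mathsf{SSYT}_{(k,k,k)}\\ \mathsf{type}(S)=T}} s_{\mathsf{shape}(S)}. \]
   Context: $s_\lambda$ is the Schur function, $s_k=s_{(k)}$, and $f[g]$ denotes plethysm of symmetric functions. Tableaux: rows are numbered $1,2,3,\dots$ with row 1 the longest; entries weakly increase along rows and strictly increase along columns (from row 1 to row 2 to row 3). The four standard tableaux of size 3 are: $T_a$, the single row $1,2,3$ (shape $(3)$); $T_b$, row 1 $=1,2$ and row 2 $=3$ (shape $(2,1)$); $T_c$, row 1 $=1,3$ and row 2 $=2$ (shape $(2,1)$); $T_d$, the single column with row $i$ containing $i$ (shape $(1,1,1)$). The transpose $T^t$ of a standard tableau is obtained by reflecting in the main diagonal: $T_a^t=T_d$, $T_d^t=T_a$, $T_b^t=T_c$, $T_c^t=T_b$. $\mathsf{SSYT}_{(k,k,k)}$ is the set of semistandard Young tableaux containing exactly $k$ entries $1$, $k$ entries $2$ and $k$ entries $3$; $\mathsf{shape}(S)$ is the shape of $S$. For such $S$ let $N_r$ be the number of cells with entry $r$ in row 2 of $S$. The type of $S\in\mathsf{SSYT}_{(k,k,k)}$ is defined recursively: (1) if $k=1$ and $S$ is standard, $\mathsf{type}(S)=S$; (2) otherwise, if $S$ has one or two rows: $\mathsf{type}(S)=T_a$ if $N_2$ is even, $N_3\ge 2N_2$ and $N_3\ne 2N_2+1$; $\mathsf{type}(S)=T_d$ if $N_2$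 is odd, $N_3\ge 2N_2$ and $N_3\ne 2N_2+1$; $\mathsf{type}(S)=T_b$ if $N_2$ is even and ($N_3<2N_2$ or $N_3=2N_2+1$); $\mathsf{type}(S)=T_c$ if $N_2$ is odd and ($N_3<2N_2$ or $N_3=2N_2+1$); (3) if $S$ has three rows, let $\overline S$ be $S$ with its first column removed (an element of $\mathsf{SSYT}_{(k-1,k-1,k-1)}$) and set $\mathsf{type}(S)=\mathsf{type}(\overline S)^t$. *)

(* Defs.v *)
From HB Require Import structures.
From mathcomp Require Import all_boot all_order all_algebra.
From mathcomp Require Export mpoly.
From Stdlib Require Import ClassicalEpsilon.

Set Implicit Arguments.
Unset Strict Implicit.
Unset Printing Implicit Defensive.

Import GRing.Theory.
Local Open Scope ring_scope.

(** * Tableaux *)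

(* The list of the rows, longest row first, with entries counted from 1; the
   shape of a tableau is then [seq.shape], the list of the row lengths. *)
Definition tableau := seq (seq nat).

Definition row_above (r s : seq nat) : bool :=
  (size s <= size r)%N &&
  all (fun j => (nth 0 r j < nth 0 s j)%N) (iota 0 (size s)).

Definition semistandard (t : tableau) : bool :=
  [&& all (fun r => r != [::]) t, all (sorted leq) t & sorted row_above t].

Definition standard (t : tableau) : bool :=
  semistandard t && perm_eq (flatten t) (iota 1 (size (flatten t))).

Definition transpose (t : tableau) : tableau :=
  [seq [seq nth 0%N r j | r <- t & (j < size r)%N]
     | j <- iota 0 (size (head [::] t))].

Definition remove_first_column (t : tableau) : tableau :=
  [seq r <- map behead t | r != [::]].

Definition T_a : tableau := [:: [:: 1; 2; 3]]%N.
Definition T_b : tableau := [:: [:: 1; 2]; [:: 3]]%N.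
Definition T_c : tableau := [:: [:: 1; 3]; [:: 2]]%N.
Definition T_d : tableau := [:: [:: 1]; [:: 2]; [:: 3]]%N.

(* A finite type containing all tableaux with at most [N] cells and entries in
   1..n; the ordinal [i : 'I_n] stands for the entry [i + 1]. *)
Definition filling (n N : nat) := N.-bseq (N.-bseq 'I_n).

Definition tableau_of (n N : nat) (S : filling n N) : tableau :=
  [seq [seq (i : 'I_n).+1 | i <- (r : N.-bseq 'I_n)] | r <- S].

Definition SSYT (n : nat) (la : seq nat) : {set filling n (sumn la)} :=
  [set S | semistandard (tableau_of S) && (shape (tableau_of S) == la)].

Definition SSYTkkk (k : nat) : {set filling 3 (3 * k)} :=
  [set S | semistandard (tableau_of S) &&
           perm_eq (flatten (tableau_of S)) (nseq k 1 ++ nseq k 2 ++ nseq k 3)%N].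

(** * The type of a tableau in SSYT_(k,k,k) *)

Definition row2_count (r : nat) (S : tableau) : nat := count_mem r (nth [::] S 1).

Definition two_row_type (S : tableau) : tableau :=
  let N2 := row2_count 2 S in
  let N3 := row2_count 3 S in
  if (2 * N2 <= N3)%N && (N3 != 2 * N2 + 1)%N
  then if odd N2 then T_d else T_a
  else if odd N2 then T_c else T_b.

(* The last branch is not reached when [k >= 1] and [S] has k entries 1,
   k entries 2 and k entries 3. *)
Fixpoint type_of (k : nat) (S : tableau) : tableau :=
  if (k == 1)%N && standard S then S
  else if (size S <= 2)%N then two_row_type S
  else if k is k'.+1 then transpose (type_of k' (remove_first_column S))
  else [::].

(** * Symmetric functions *)

(* A symmetric function f with rational coefficients is given by the family of
   its truncations f(x_1, ..., x_n) for all n, that is, as an element of the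
   inverse limit of the rings of symmetric polynomials in n variables; the
   variable x_(i+1) is ['X_i]. *)
Definition symfun := forall n : nat, {mpoly rat[n]}.

(* [la] is meant to be a partition without zero parts; otherwise [SSYT n la] is
   empty. *)
Definition schur (la : seq nat) : symfun := fun n =>
  \sum_(S in SSYT n la) \prod_(r <- S) \prod_(i <- (r : (sumn la).-bseq 'I_n)) 'X_i.

Definition psum (m : nat) : symfun := fun n => \sum_(i < n) 'X_i ^+ m.

(* p_m[g] = g(x_1^m, x_2^m, ...) *)
Definition psum_plethysm (m : nat) (g : symfun) : symfun := fun n =>
  comp_mpoly [tuple 'X_i ^+ m | i < n] (g n).

(* P(f_1, ..., f_d), for the polynomial P in d variables. *)
Definition symfun_eval (d : nat) (P : {mpoly rat[d]}) (f : nat -> symfun) :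
    symfun := fun n =>
  comp_mpoly [tuple f (i : 'I_d).+1 n | i < d] P.

(* Writing f = P(p_1, ..., p_d), which is possible for every symmetric function
   f, in an essentially unique way since the p_m are algebraically independent
   generators over the rationals, f[g] = P(p_1[g], ..., p_d[g]): the map
   f |-> f[g] is the algebra morphism sending p_m to p_m[g]. *)
Definition plethysm (f g : symfun) : symfun :=
  let dP := epsilon (inhabits (existT (fun d => {mpoly rat[d]}) 0%N 0))
              (fun dP => forall n, f n = symfun_eval (projT2 dP) psum n) in
  symfun_eval (projT2 dP) (fun m => psum_plethysm m g).

(* Main.v *)
(** Write H = h_k, H2 = p_2[h_k], H3 = p_3[h_k], and A, B, C, D for the four
    right-hand sides. Expanding s_(3), s_(2,1), s_(1,1,1) in power sums, it is
    enough to prove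
      A + B + C + D = H^3, B = C, A - D = H H2, 2 (A + D) - (B + C) = 2 H3.
    The shapes involved have at most three rows, and a tableau of shape l in
    SSYT_(k,k,k) is determined by one number i running through an interval, so
    each left-hand side is the sum of c(l + (2,1,0)) s_l for an explicit function
    c: the smaller gap of l + (2,1,0), 0, a sign or 0 depending on parities,
    and twice a sign or 0 depending on residues mod 3, respectively. These functions
    extend antisymmetrically to all triples, so the Jacobi-Trudi formula turns
    the sum into the sum over all triples g with |g| = 3k of
    c(g + (2,1,0)) h_(g1) h_(g2) h_(g3). For the first and third function,
    symmetrizing in g gives H^3 and H H2, where
    p_2[h_k] = sum_(a+b=2k) (-1)^a h_a h_b; for the last one, induction on the
    number of variables gives H3. *)
Require Import Defs.
From mathcomp Require Import all_boot all_order all_algebra.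
From mathcomp Require Import ring zify.
From Stdlib Require Import ClassicalEpsilon.

Set Implicit Arguments.
Unset Strict Implicit.
Unset Printing Implicit Defensive.

Import GRing.Theory.
Local Open Scope ring_scope.

(** * Sums over triples of natural numbers with a given total *)

Section TripleSums.
Variable R : comNzRingType.
Implicit Types F G : nat -> nat -> nat -> R.

(** [B] only makes the sum finite: for [m < B] it runs over all triples of total [m]. *)
Definition triple_sum (B m : nat) F : R :=
  \sum_(0 <= a < B) \sum_(0 <= b < B) \sum_(0 <= c < B)
    if (a + b + c == m)%N then F a b c else 0.

Lemma eq_triple_sum B m F G :
  (forall a b c, (a + b + c = m)%N -> F a b c = G a b c) ->
  triple_sum B m F = triple_sum B m G.
Proof.
move=> eFG; apply: eq_bigr => a _; apply: eq_bigr => b _; apply: eq_bigr => c _.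
by case: eqP => // /eFG.
Qed.

Lemma triple_sumD B m F G :
  triple_sum B m (fun a b c => F a b c + G a b c) =
  triple_sum B m F + triple_sum B m G.
Proof.
rewrite -big_split; apply: eq_bigr => a _ /=; rewrite -big_split.
apply: eq_bigr => b _ /=; rewrite -big_split; apply: eq_bigr => c _ /=.
by case: ifP; rewrite ?addr0.
Qed.

Lemma triple_sumZ B m z F :
  triple_sum B m (fun a b c => z * F a b c) = z * triple_sum B m F.
Proof.
rewrite mulr_sumr; apply: eq_bigr => a _; rewrite mulr_sumr.
apply: eq_bigr => b _; rewrite mulr_sumr; apply: eq_bigr => c _.
by case: ifP; rewrite ?mulr0.
Qed.

Lemma triple_sum0 B m : triple_sum B m (fun _ _ _ => 0) = 0.
Proof.
by apply: big1 => a _; apply: big1 => b _; apply: big1 => c _; rewrite if_same.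
Qed.

Lemma triple_sum_swap12 B m F :
  triple_sum B m F = triple_sum B m (fun a b c => F b a c).
Proof.
rewrite /triple_sum exchange_big; apply: eq_bigr => a _; apply: eq_bigr => b _.
by apply: eq_bigr => c _; rewrite [(b + a)%N]addnC.
Qed.

Lemma triple_sum_swap23 B m F :
  triple_sum B m F = triple_sum B m (fun a b c => F a c b).
Proof.
rewrite /triple_sum; apply: eq_bigr => a _; rewrite exchange_big /=; apply: eq_bigr => b _.
by apply: eq_bigr => c _; rewrite addnAC.
Qed.

Lemma triple_sum_shift1 B m F : (m.+1 < B)%N -> (forall b c, F 0%N b c = 0) ->
  triple_sum B m.+1 F = triple_sum B m (fun a b c => F a.+1 b c).
Proof.
case: B => // B ltmB F0; rewrite /triple_sum big_nat_recl //= [RHS]big_nat_recr //=.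
rewrite [X in X + _ = _]big1 ?add0r => [|b _]; last first.
  by apply: big1 => c _; rewrite F0 if_same.
rewrite [X in _ = _ + X]big1 ?addr0 => [|b _]; last first.
  by apply: big1 => c _; case: eqP => // *; lia.
by apply: eq_bigr => a _; apply: eq_bigr => b _; apply: eq_bigr => c _; rewrite !addSn eqSS.
Qed.

Lemma triple_sum_shift2 B m F : (m.+1 < B)%N -> (forall a c, F a 0%N c = 0) ->
  triple_sum B m.+1 F = triple_sum B m (fun a b c => F a b.+1 c).
Proof.
by move=> ltmB F0; rewrite triple_sum_swap12 triple_sum_shift1 // triple_sum_swap12.
Qed.

Lemma triple_sum_shift3 B m F : (m.+1 < B)%N -> (forall a b, F a b 0%N = 0) ->
  triple_sum B m.+1 F = triple_sum B m (fun a b c => F a b c.+1).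
Proof.
by move=> ltmB F0; rewrite triple_sum_swap23 triple_sum_shift2 // triple_sum_swap23.
Qed.

Lemma triple_sum_delta B a b c F : (a < B)%N -> (b < B)%N -> (c < B)%N ->
  triple_sum B (a + b + c)
    (fun a' b' c' => if [&& a' == a, b' == b & c' == c]%N then F a' b' c' else 0) = F a b c.
Proof.
move=> ltaB ltbB ltcB; rewrite /triple_sum !big_mkord.
rewrite (bigD1 (Ordinal ltaB)) //= !big_mkord (bigD1 (Ordinal ltbB)) //= !big_mkord.
rewrite (bigD1 (Ordinal ltcB)) //= !eqxx !big1 ?addr0 //.
- move=> a' /negPf nea; rewrite big1 // => b' _; rewrite big1 // => c' _.
  by rewrite -val_eqE /= in nea; rewrite nea if_same.
- move=> b' /negPf neb; rewrite big_mkord big1 // => c' _.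
  by rewrite -val_eqE /= in neb; rewrite neb andbF if_same.
- move=> c' /negPf nec; rewrite -val_eqE /= in nec.
  by rewrite nec if_same.
Qed.

End TripleSums.

(** * Complete homogeneous polynomials and the branching rule for Jacobi-Trudi determinants *)

Section Complete.
Variables (R : comNzRingType) (y : nat -> R).

(** h_m(y_1, ..., y_n), computed by separating the monomials that contain the last variable from
    those that do not. *)
Fixpoint complete (n : nat) : nat -> R :=
  if n is n'.+1 then
    fix F m := if m is m'.+1 then complete n' m + y n'.+1 * F m' else complete n' 0
  else fun m => (m == 0%N)%:R.

Lemma completeS n m :
  complete n.+1 m.+1 = complete n m.+1 + y n.+1 * complete n.+1 m.
Proof. by []. Qed.

Lemma complete0 n : complete n 0 = 1.
Proof. by elim: n. Qed.

(* [scomplete n b] is h_(b-2), with the convention that h_(-2) = h_(-1) = 0. *)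
Definition scomplete (n b : nat) : R := if b is b'.+2 then complete n b' else 0.

Arguments complete : simpl never.
Arguments scomplete : simpl never.

Lemma scompleteS n b :
  scomplete n.+1 b.+1 = scomplete n b.+1 + y n.+1 * scomplete n.+1 b.
Proof. by case: b => [|[|b]]; rewrite /scomplete ?mulr0 ?addr0. Qed.

(** Iterates [scompleteS] from index a + t down to c + t. In the determinant the leading term is a
    multiple of another row, which row operations remove. *)
Lemma scomplete_sum n t a c : (c <= a)%N ->
  scomplete n.+1 (a + t) = y n.+1 ^+ (a - c) * scomplete n.+1 (c + t)
    + \sum_(c <= b < a) y n.+1 ^+ (a.-1 - b) * scomplete n (b.+1 + t).
Proof.
move=> /subnKC <-; elim: (a - c)%N => [|d IHd].
  by rewrite addn0 subnn big_geq // mul1r addr0.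
rewrite addnS addSn scompleteS IHd big_nat_recr ?leq_addr //= subnn expr0 mul1r.
have -> : ((c + d).+1 - c = (c + d - c).+1)%N by lia.
rewrite -(addSn _ t) mulrDr mulrA -exprS [LHS]addrC -addrA; congr (_ + (_ + _)).
rewrite mulr_sumr !big_nat; apply: eq_bigr => b /andP[lecb ltb].
by rewrite mulrA -exprS; congr (_ ^+ _ * _); lia.
Qed.

(* The determinant of the matrix with rows (h_(b-2), h_(b-1), h_b), for b = b1, b2, b3. *)
Definition jacobi_trudi (n b1 b2 b3 : nat) : R :=
  let s := scomplete n in
  s b1 * (s b2.+1 * s b3.+2 - s b2.+2 * s b3.+1)
  - s b1.+1 * (s b2 * s b3.+2 - s b2.+2 * s b3)
  + s b1.+2 * (s b2 * s b3.+1 - s b2.+1 * s b3).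

Lemma sum_lin3 (I : Type) (r : seq I) (z f1 f2 f3 : I -> R) (a1 a2 a3 : R) :
  \sum_(i <- r) z i * (a1 * f1 i + a2 * f2 i + a3 * f3 i) =
  a1 * (\sum_(i <- r) z i * f1 i) + a2 * (\sum_(i <- r) z i * f2 i)
   + a3 * (\sum_(i <- r) z i * f3 i).
Proof.
rewrite !mulr_sumr -!big_split; apply: eq_bigr => i _ /=; ring.
Qed.

(** Unrolling each row down to the index of the next row leaves sums over exactly the interlacing
    ranges; multilinearity of the determinant then pulls these sums out. *)
Lemma jacobi_trudi_branching n l1 l2 l3 : (l3 <= l2 <= l1)%N ->
  jacobi_trudi n.+1 l1.+2 l2.+1 l3 =
  \sum_(l2 <= m1 < l1.+1) \sum_(l3 <= m2 < l2.+1) \sum_(0 <= m3 < l3.+1)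
     y n.+1 ^+ (l1 - m1) * (y n.+1 ^+ (l2 - m2) * (y n.+1 ^+ (l3 - m3)
       * jacobi_trudi n m1.+2 m2.+1 m3)).
Proof.
move=> /andP[le32 le21]; set z := y n.+1.
pose r1 t := \sum_(l2 <= m1 < l1.+1) z ^+ (l1 - m1) * scomplete n (m1.+2 + t).
pose r2 t := \sum_(l3 <= m2 < l2.+1) z ^+ (l2 - m2) * scomplete n (m2.+1 + t).
pose r3 t := \sum_(0 <= m3 < l3.+1) z ^+ (l3 - m3) * scomplete n (m3 + t).
have row1 t : scomplete n.+1 (l1.+2 + t) =
    z ^+ (l1.+1 - l2) * scomplete n.+1 (l2.+1 + t) + r1 t.
  rewrite (@scomplete_sum _ t l1.+2 l2.+1) ?subSS; last by rewrite ltnS leqW.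
  congr (_ + _).
  by rewrite big_add1 /=; apply: eq_bigr => m _; rewrite -subSS.
have row2 t : scomplete n.+1 (l2.+1 + t) =
    z ^+ (l2.+1 - l3) * scomplete n.+1 (l3 + t) + r2 t.
  by rewrite (@scomplete_sum _ t l2.+1 l3) // ltnW.
(* For t <= 2 the boundary term is h_(-2), h_(-1) or h_0, which does not depend on the number of
   variables, so it becomes the m3 = 0 term of [r3]. *)
have row3 t : (t <= 2)%N -> scomplete n.+1 (l3 + t) = r3 t.
  move=> le_t2; rewrite (@scomplete_sum _ t l3 0) // /r3 big_nat_recl //= subn0 add0n.
  congr (_ + _); first by move: t le_t2 => [|[|[|]]].
  rewrite !big_nat; apply: eq_bigr => m ltm; congr (_ ^+ _ * _); lia.
(* Row operations: the multiples of row 2 in row 1 and of row 3 in row 2 drop out. *)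
have -> : jacobi_trudi n.+1 l1.+2 l2.+1 l3 =
    r1 0 * (r2 1 * r3 2 - r2 2 * r3 1) - r1 1 * (r2 0 * r3 2 - r2 2 * r3 0)
     + r1 2 * (r2 0 * r3 1 - r2 1 * r3 0).
  have := (row1 0, row1 1, row1 2, row2 0, row2 1, row2 2)%N.
  have := (row3 0 isT, row3 1 isT, row3 2 isT)%N.
  rewrite /jacobi_trudi !addn0 !addn1 !addn2 => -[[-> ->] ->] [[[[[-> -> ->] ->] ->] ->]]; ring.
rewrite [RHS](eq_bigr (fun m1 => z ^+ (l1 - m1) *
    ((r2 1 * r3 2 - r2 2 * r3 1) * scomplete n (m1.+2 + 0)
     + (- (r2 0 * r3 2 - r2 2 * r3 0)) * scomplete n (m1.+2 + 1)
     + (r2 0 * r3 1 - r2 1 * r3 0) * scomplete n (m1.+2 + 2)))); last first.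
  move=> m1 _; under eq_bigr do rewrite -mulr_sumr; rewrite -mulr_sumr; congr (_ * _).
  rewrite (eq_bigr (fun m2 => z ^+ (l2 - m2) *
     ((scomplete n m1.+4 * r3 1 - scomplete n m1.+3 * r3 2) * scomplete n (m2.+1 + 0)
     + (scomplete n m1.+2 * r3 2 - scomplete n m1.+4 * r3 0) * scomplete n (m2.+1 + 1)
     + (scomplete n m1.+3 * r3 0 - scomplete n m1.+2 * r3 1) * scomplete n (m2.+1 + 2)))); last first.
    move=> m2 _; rewrite -mulr_sumr; congr (_ * _).
    rewrite (eq_bigr (fun m3 => z ^+ (l3 - m3) *
     ((scomplete n m1.+3 * scomplete n m2.+3 - scomplete n m1.+4 * scomplete n m2.+2) * scomplete n (m3 + 0)
     + (scomplete n m1.+4 * scomplete n m2.+1 - scomplete n m1.+2 * scomplete n m2.+3) * scomplete n (m3 + 1)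
     + (scomplete n m1.+2 * scomplete n m2.+2 - scomplete n m1.+3 * scomplete n m2.+1) * scomplete n (m3 + 2)))).
      rewrite sum_lin3 -!/(r3 _) !addn0 !addn1 !addn2; ring.
    move=> m3 _; rewrite /jacobi_trudi !addn0 !addn1 !addn2; congr (_ * _); ring.
  rewrite sum_lin3 -!/(r2 _) !addn0 !addn1 !addn2; ring.
rewrite sum_lin3 -!/(r1 _); ring.
Qed.

End Complete.

(** * Antisymmetric coefficients and symmetrization *)

Definition antisymmetric3 (c : nat -> nat -> nat -> int) : Prop :=
  (forall a b d, c b a d = - c a b d) /\ (forall a b d, c a d b = - c a b d).

Section Antisymmetrization.
Variables (R : comNzRingType) (y : nat -> R).
Local Notation h := (complete y).
Local Notation s := (scomplete y).

(* The Jacobi-Trudi determinant is an alternating sum over S_3; moving the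
   permutation onto the antisymmetric [c] collapses it to a single product. *)
Lemma triple_sum_antisymmetric n B N c : antisymmetric3 c ->
  triple_sum B N (fun b1 b2 b3 => (c b1 b2 b3)%:~R * (s n b1 * s n b2.+1 * s n b3.+2)) =
  triple_sum B N (fun b1 b2 b3 => if (b3 < b2 < b1)%N
    then (c b1 b2 b3)%:~R * jacobi_trudi y n b1 b2 b3 else 0).
Proof.
move=> [c12 c23].
set F := fun b1 b2 b3 : nat => _ * (_ * _ * _).
have c11 a d : c a a d = 0 by have := c12 a a d; lia.
have c22 a d : c d a a = 0 by have := c23 d a a; lia.
have c33 a d : c a d a = 0 by rewrite c23 c11 oppr0.
pose chamber (p : nat -> nat -> nat -> bool) a b d := if p a b d then F a b d else 0.
(* Antisymmetry kills triples with two equal entries; the others split into the six strict orders,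
   each of which is then carried to d < b < a by transpositions. *)
transitivity (triple_sum B N (fun a b d =>
    chamber (fun a b d => d < b < a)%N a b d + (chamber (fun a b d => d < a < b)%N a b d
   + (chamber (fun a b d => b < d < a)%N a b d + (chamber (fun a b d => a < d < b)%N a b d
   + (chamber (fun a b d => b < a < d)%N a b d + chamber (fun a b d => a < b < d)%N a b d)))))).
  apply: eq_triple_sum => a b d _; rewrite /chamber.
  have [-> | neab] := eqVneq a b.
    by rewrite !ltnn !andbF /F c11 mul0r !if_same !add0r.
  have [-> | nebd] := eqVneq b d.
    by rewrite !ltnn !andbF /F c22 mul0r !if_same !add0r.
  have [-> | nead] := eqVneq a d.
    by rewrite !ltnn !andbF /F c33 mul0r !if_same !add0r.
  by do 6![case: ifP => ?; rewrite ?addr0 ?add0r; try lia].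
rewrite !triple_sumD.
rewrite [X in _ + (X + _)]triple_sum_swap12 [X in _ + (_ + (X + _))]triple_sum_swap23.
rewrite [X in _ + (_ + (_ + (X + _)))]triple_sum_swap12.
rewrite [X in _ + (_ + (_ + (X + _)))]triple_sum_swap23.
rewrite [X in _ + (_ + (_ + (_ + (X + _))))]triple_sum_swap23.
rewrite [X in _ + (_ + (_ + (_ + (X + _))))]triple_sum_swap12.
rewrite [X in _ + (_ + (_ + (_ + (_ + X))))]triple_sum_swap12.
rewrite [X in _ + (_ + (_ + (_ + (_ + X))))]triple_sum_swap23.
rewrite [X in _ + (_ + (_ + (_ + (_ + X))))]triple_sum_swap12.
rewrite -!triple_sumD; apply: eq_triple_sum => a b d _; rewrite /chamber.
case: ifP => _; last by rewrite !addr0.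
rewrite /F [c b d a]c23 [c d b a]c12 [c b d a]c23 [c b a d]c12 [c d a b]c12 [c a d b]c23.
rewrite /jacobi_trudi !rmorphN /=; ring.
Qed.

(** The product on the left is h_(b1-2) h_(b2-1) h_(b3), which vanishes for b1 < 2 or b2 < 1, so the
    indices can be shifted by (2,1,0). *)
Lemma triple_sum_scomplete n B N (c : nat -> nat -> nat -> int) : (N.+3 < B)%N ->
  triple_sum B N.+3 (fun b1 b2 b3 => (c b1 b2 b3)%:~R * (s n b1 * s n b2.+1 * s n b3.+2)) =
  triple_sum B N (fun a b d => (c a.+2 b.+1 d)%:~R * (h n a * h n b * h n d)).
Proof.
move=> ltNB; rewrite triple_sum_shift1 //; last by move=> *; rewrite !mul0r mulr0.
rewrite triple_sum_shift1; [|lia|by move=> *; rewrite !mul0r mulr0].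
by rewrite triple_sum_shift2 => //; [lia|by move=> *; rewrite mulr0 mul0r mulr0].
Qed.

Definition sum_perm3 (T : nmodType) (e : nat -> nat -> nat -> T) (a b d : nat) : T :=
  e a b d + e b a d + e a d b + e d a b + e b d a + e d b a.

Lemma triple_sum_perm3 B N (F : nat -> nat -> nat -> R) :
  triple_sum B N (sum_perm3 F) = 6%:R * triple_sum B N F.
Proof.
rewrite /sum_perm3 !triple_sumD.
have e2 := triple_sum_swap12 B N F; have e3 := triple_sum_swap23 B N F.
have e4 := triple_sum_swap23 B N (fun a b c => F b a c).
have e5 := triple_sum_swap12 B N (fun a b c => F a c b).
have e6 := triple_sum_swap12 B N (fun a b c => F c a b).
rewrite -e6 -e5 -e4 -e3 -e2; ring.
Qed.

End Antisymmetrization.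

(** The product of the three h's is symmetric, so only the symmetrized coefficients matter, up to
    the factor 6, which can be cancelled. *)
Lemma triple_sum_symmetrize (R : idomainType) (y : nat -> R) n B N
    (e1 e2 : nat -> nat -> nat -> int) :
  (6%:R != 0 :> R) ->
  (forall a b d, (a + b + d = N)%N -> sum_perm3 e1 a b d = sum_perm3 e2 a b d) ->
  let hhh a b d := complete y n a * complete y n b * complete y n d in
  triple_sum B N (fun a b d => (e1 a b d)%:~R * hhh a b d) =
  triple_sum B N (fun a b d => (e2 a b d)%:~R * hhh a b d).
Proof.
move=> nz6 e12 hhh; apply: (mulfI nz6); rewrite -!triple_sum_perm3.
apply: eq_triple_sum => a b d /e12 eabd.
have sumE e : sum_perm3 (fun a b d => (e a b d)%:~R * hhh a b d) a b d =
    (sum_perm3 e a b d)%:~R * hhh a b d.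
  by rewrite /sum_perm3 /hhh !rmorphD /=; ring.
by rewrite !sumE eabd.
Qed.

(** * Complete homogeneous polynomials in the squares and cubes of the variables *)

Section PowerSums.
Variables (R : comNzRingType) (y : nat -> R) (B : nat).
Local Notation h := (complete y).

Definition predc n m : R := if m is m'.+1 then h n m' else 0.

Lemma complete_sub n m : h n m = h n.+1 m - y n.+1 * predc n.+1 m.
Proof. by case: m => [|m]; rewrite ?mulr0 ?subr0 // completeS addrK. Qed.

(** This is the coefficient of t^(2m) in H(t) H(-t) = prod_i 1/(1 - y_i^2 t^2), with the first index
    frozen at [k] to give it the form of a triple sum. The proof is by induction on the number of
    variables. *)
Lemma complete_power2 n k m : (2 * m + k < B)%N ->
  triple_sum B (2 * m + k)
    (fun a b c => (if a == k then (-1) ^+ b else 0) * (h n b * h n c)) =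
  complete (fun i => y i ^+ 2) n m.
Proof.
elim: n m => [|n IHn] m ltmB.
  rewrite (_ : triple_sum _ _ _ = triple_sum B (2 * m + k)
      (fun a b c => if [&& a == k, b == 0 & c == 0]%N then 1 else 0)); last first.
    apply: eq_triple_sum => a b c _ /=; case: eqP => _; rewrite ?mul0r //=.
    by case: b c => [|b] [|c]; rewrite ?mul0r ?mulr0 ?mulr1.
  case: m ltmB => [|m] ltkB.
    by rewrite -[(2 * 0 + k)%N]addn0 -[X in triple_sum _ X]addn0 triple_sum_delta //; lia.
  rewrite (@eq_triple_sum _ _ _ _ (fun _ _ _ => 0)) ?triple_sum0 // => a b c abc.
  by case: ifP => // /and3P[/eqP ? /eqP ? /eqP ?]; lia.
elim: m ltmB => [|m IHm] ltmB.
  rewrite /= -(IHn 0%N ltmB); apply: eq_triple_sum => a b c; rewrite muln0 => abck.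
  case: eqP => [ak|_]; last by rewrite !mul0r.
  have -> : b = 0%N by lia.
  by have -> : c = 0%N by lia.
rewrite completeS -IHn // -IHm; last lia.
pose e a b : R := if a == k then (-1) ^+ b else 0.
change (triple_sum B (2 * m.+1 + k) (fun a b c => e a b * (h n.+1 b * h n.+1 c)) =
  triple_sum B (2 * m.+1 + k) (fun a b c => e a b * (h n b * h n c)) + y n.+1 ^+ 2 *
  triple_sum B (2 * m + k) (fun a b c => e a b * (h n.+1 b * h n.+1 c))).
have eS a b : e a b.+1 = - e a b by rewrite /e; case: eqP; rewrite ?oppr0 // exprS mulN1r.
rewrite [X in _ = X + _](@eq_triple_sum _ _ _ _ (fun a b c => e a b * (h n.+1 b * h n.+1 c)
   + ((- y n.+1) * (e a b * (predc n.+1 b * h n.+1 c)) + ((- y n.+1) * (e a b * (h n.+1 b * predc n.+1 c))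
   + y n.+1 ^+ 2 * (e a b * (predc n.+1 b * predc n.+1 c)))))); last first.
  by move=> a b c _; rewrite ![h n _]complete_sub; ring.
rewrite !triple_sumD !triple_sumZ -addrA; set S := triple_sum _ _ _.
rewrite -[LHS]addr0; congr (_ + _).
have -> : (2 * m.+1 + k = (2 * m + k).+2)%N by lia.
rewrite triple_sum_shift2 /=; [|lia|by move=> *; rewrite mul0r mulr0].
rewrite [X in _ + (_ * X + _)]triple_sum_shift3 /=; [|lia|by move=> *; rewrite !mulr0].
rewrite [X in _ + (_ + _ * X)]triple_sum_shift2 /=; [|lia|by move=> *; rewrite mul0r mulr0].
rewrite [X in _ + (_ + _ * X)]triple_sum_shift3 /=; [|lia|by move=> *; rewrite !mulr0].
(* Raising [b] flips the sign: the two terms with factor [y n.+1] cancel, and the one with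
   [y n.+1 ^+ 2] cancels the term coming from [completeS]. *)
have eN f N : triple_sum B N (fun a b c => e a b.+1 * f b c) =
   - triple_sum B N (fun a b c => e a b * f b c).
  rewrite -mulN1r -triple_sumZ; apply: eq_triple_sum => a b c _.
  by rewrite eS; ring.
rewrite !(eN (fun b c => h n.+1 b * h n.+1 c)); ring.
Qed.

(** The sign of the residues mod 3 as a permutation of (2,1,0), and 0 if two residues agree. *)
Definition sgn_mod3 (a b c : nat) : int :=
  ((a == b.+1 %[mod 3]) && (b == c.+1 %[mod 3]))%:Z
  - ((b == a.+1 %[mod 3]) && (c == b.+1 %[mod 3]))%:Z.

Ltac case_mod3 a b c :=
  rewrite /sgn_mod3 (divn_eq a 3) (divn_eq b 3) (divn_eq c 3) -!addnS !modnMDl;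
  move: (a %% 3)%N (b %% 3)%N (c %% 3)%N (@ltn_pmod a 3 isT) (@ltn_pmod b 3 isT) (@ltn_pmod c 3 isT);
  do 3![case=> [|[|[|//]]]].

Lemma sgn_mod3_antisymmetric : antisymmetric3 sgn_mod3.
Proof. by split=> a b c; case_mod3 a b c. Qed.

(** Up to a constant, [sgn_mod3] is the determinant with rows (1, w^a, w^(2a)), and likewise for b
    and c, where w is a primitive cube root of unity. Hence the elementary symmetric functions of
    the three shift operators act on it as those of 1, w, w^2, that is, as 0, 0 and 1; these are the
    three relations here and below. *)
Lemma sgn_mod3_sum1 a b c :
  sgn_mod3 a.+1 b c + sgn_mod3 a b.+1 c + sgn_mod3 a b c.+1 = 0.
Proof. by case_mod3 a b c. Qed.

Lemma sgn_mod3_sum2 a b c :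
  sgn_mod3 a.+1 b.+1 c + sgn_mod3 a.+1 b c.+1 + sgn_mod3 a b.+1 c.+1 = 0.
Proof. by case_mod3 a b c. Qed.

Lemma sgn_mod3_sum3 a b c : sgn_mod3 a.+1 b.+1 c.+1 = sgn_mod3 a b c.
Proof. by case_mod3 a b c. Qed.

(* Substitutes h_m(n) = h_m(n+1) - y_(n+1) h_(m-1)(n+1) in each factor. *)
Lemma complete_power3_step (u : nat -> nat -> nat -> int) n N : (N.+3 < B)%N ->
  let S n m v := triple_sum B m (fun a b c => (v a b c)%:~R * (h n a * h n b * h n c)) in
  S n N.+3 u = S n.+1 N.+3 u
   - y n.+1 * S n.+1 N.+2 (fun a b c => u a.+1 b c + u a b.+1 c + u a b c.+1)
   + y n.+1 ^+ 2 * S n.+1 N.+1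
        (fun a b c => u a.+1 b.+1 c + u a.+1 b c.+1 + u a b.+1 c.+1)
   - y n.+1 ^+ 3 * S n.+1 N (fun a b c => u a.+1 b.+1 c.+1).
Proof.
move=> ltNB S; rewrite {1}/S; set z := y n.+1.
pose t v (f1 f2 f3 : nat -> R) m : R :=
  triple_sum B m (fun a b c => (v a b c : int)%:~R * (f1 a * f2 b * f3 c)).
pose g := h n.+1; pose p := predc n.+1.
have -> : triple_sum B N.+3 (fun a b c => (u a b c)%:~R * (h n a * h n b * h n c)) =
   t u g g g N.+3 + ((- z) * t u p g g N.+3 + ((- z) * t u g p g N.+3 + ((- z) * t u g g p N.+3
   + (z ^+ 2 * t u p p g N.+3 + (z ^+ 2 * t u p g p N.+3 + (z ^+ 2 * t u g p p N.+3
   + (- z ^+ 3) * t u p p p N.+3)))))).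
  rewrite /t -!triple_sumZ -!triple_sumD; apply: eq_triple_sum => a b c _.
  by rewrite ![h n _]complete_sub /p /g /z; ring.
have t1 v f2 f3 m : (m.+1 < B)%N -> t v p f2 f3 m.+1 = t (fun a b c => v a.+1 b c) g f2 f3 m.
  by move=> ltm; rewrite /t triple_sum_shift1 // => *; rewrite /= !(mul0r, mulr0).
have t2 v f1 f3 m : (m.+1 < B)%N -> t v f1 p f3 m.+1 = t (fun a b c => v a b.+1 c) f1 g f3 m.
  by move=> ltm; rewrite /t triple_sum_shift2 // => *; rewrite /= !(mul0r, mulr0).
have t3 v f1 f2 m : (m.+1 < B)%N -> t v f1 f2 p m.+1 = t (fun a b c => v a b c.+1) f1 f2 g m.
  by move=> ltm; rewrite /t triple_sum_shift3 // => *; rewrite /= !(mul0r, mulr0).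
have ltNB2 : (N.+2 < B)%N by lia.
have ltNB1 : (N.+1 < B)%N by lia.
have SD m v1 v2 v3 : S n.+1 m (fun a b c => v1 a b c + v2 a b c + v3 a b c) =
    t v1 g g g m + t v2 g g g m + t v3 g g g m.
  by rewrite /S /t -!triple_sumD; apply: eq_triple_sum => a b c _; rewrite !rmorphD /g; ring.
rewrite !SD.
rewrite (t3 _ p p) // (t3 _ p g) // (t3 _ g p) // (t3 _ g g) //.
rewrite !(t2 _ p g) // !(t2 _ g g) // !(t1 _ g g) //=.
rewrite -[S n.+1 N.+3 u]/(t u g g g N.+3).
rewrite -[S n.+1 N _]/(t (fun a b c => u a.+1 b.+1 c.+1) g g g N).
ring.
Qed.

(** A symmetrized form of H(t) H(wt) H(w^2 t) = prod_i 1/(1 - y_i^3 t^3). In [complete_power3_step]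
    the terms with [y n.+1] and its square vanish, and the cubic term is the recursion for h_m in
    the cubes. *)
Lemma complete_power3 n m : (3 * m < B)%N ->
  triple_sum B (3 * m)
    (fun a b c => (sgn_mod3 a.+2 b.+1 c)%:~R * (h n a * h n b * h n c)) =
  complete (fun i => y i ^+ 3) n m.
Proof.
elim: n m => [|n IHn] m ltmB.
  rewrite (@eq_triple_sum _ _ _ _
      (fun a b c => if [&& a == 0, b == 0 & c == 0]%N then 1 else 0)); last first.
    by case=> [|a] [|b] [|c] _ /=; rewrite ?(mulr0, mul0r, mulr1).
  case: m ltmB => [|m] ltkB.
    by rewrite -[X in triple_sum _ X]/(0 + 0 + 0)%N triple_sum_delta.
  rewrite (@eq_triple_sum _ _ _ _ (fun _ _ _ => 0)) ?triple_sum0 // => a b c abc.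
  by case: ifP => // /and3P[/eqP ? /eqP ? /eqP ?]; lia.
elim: m ltmB => [|m IHm] ltmB.
  rewrite -[RHS]/(complete (fun i => y i ^+ 3) n 0) -(IHn 0%N ltmB).
  apply: eq_triple_sum => a b c; rewrite muln0 => abc.
  have -> : a = 0%N by lia.
  have -> : b = 0%N by lia.
  have -> : c = 0%N by lia.
  by rewrite !complete0.
rewrite completeS -IHn // -IHm; last lia.
rewrite (_ : 3 * m.+1 = (3 * m).+3)%N; last lia.
have := @complete_power3_step (fun a b c => sgn_mod3 a.+2 b.+1 c) n (3 * m).
rewrite /= => ->; last lia.
set S3 := triple_sum B (3 * m).+3 _.
rewrite [X in S3 - _ * X](@eq_triple_sum _ _ _ _ (fun _ _ _ => 0)); last first.
  by move=> a b c _; rewrite sgn_mod3_sum1 mul0r.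
rewrite [X in _ + _ ^+ 2 * X](@eq_triple_sum _ _ _ _ (fun _ _ _ => 0)); last first.
  by move=> a b c _; rewrite sgn_mod3_sum2 mul0r.
rewrite [X in _ - _ ^+ 3 * X](@eq_triple_sum _ _ _ _ 
  (fun a b c => (sgn_mod3 a.+2 b.+1 c)%:~R * (h n.+1 a * h n.+1 b * h n.+1 c))); last first.
  by move=> a b c _; rewrite sgn_mod3_sum3.
rewrite !triple_sum0; ring.
Qed.

End PowerSums.

(** * The coefficient functions and their symmetrizations *)

Definition alternating_extension (f : nat -> nat -> nat -> int) (a b c : nat) : int :=
  if (c < b < a)%N then f a b c else
  if (c < a < b)%N then - f b a c else
  if (b < c < a)%N then - f a c b else
  if (b < a < c)%N then f c a b else
  if (a < c < b)%N then f b c a else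
  if (a < b < c)%N then - f c b a else 0.

Ltac decide_ifs := repeat match goal with |- context [if ?b then _ else _] =>
  first [have -> : b = true by lia | have -> : b = false by lia] end.

Lemma alternating_extension_antisymmetric f :
  antisymmetric3 (alternating_extension f).
Proof.
by split=> a b c; case: (ltngtP a b) => ?; case: (ltngtP b c) => ?; case: (ltngtP a c) => ?;
  try lia; rewrite /alternating_extension; decide_ifs; rewrite ?opprK ?oppr0; lia.
Qed.

(* [kostka_coef (l + (2,1,0))] is the number of tableaux of shape l in
   SSYT_(k,k,k), and [sign_coef] is the number of those of type T_a minus the
   number of those of type T_d. *)
Definition min_gap (a b c : nat) : nat := minn (a - b) (b - c).

Definition kostka_coef := alternating_extension (fun a b c => (min_gap a b c)%:Z).

Definition sign_coef := alternating_extension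
  (fun a b c => if odd (min_gap a b c) then if odd b then 1 else -1 else 0).

(** [sum_perm3] is invariant under permutations, so it is enough to compare on weakly decreasing
    triples, parametrized by their gaps [p] and [q]. *)
Lemma sum_perm3_sorted (e1 e2 : nat -> nat -> nat -> int) N :
  (forall p q d, (d + q + p + (d + q) + d = N)%N ->
     sum_perm3 e1 (d + q + p) (d + q) d = sum_perm3 e2 (d + q + p) (d + q) d) ->
  forall a b d, (a + b + d = N)%N -> sum_perm3 e1 a b d = sum_perm3 e2 a b d.
Proof.
move=> e12 a b d abdN; have {}e12 x y z : (z <= y <= x)%N -> (x + y + z = N)%N ->
    sum_perm3 e1 x y z = sum_perm3 e2 x y z.
  move=> /andP[zy yx] xyzN; have := e12 (x - y)%N (y - z)%N z.
  by rewrite !subnKC // => -> //.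
rewrite /sum_perm3 in e12 *.
case: (leqP b a) => ba; case: (leqP d b) => db; case: (leqP d a) => da.
all: first [have := e12 a b d | exfalso; lia]; try lia.
all: first [have := e12 a d b | exfalso; lia]; try lia.
all: first [have := e12 b a d | exfalso; lia]; try lia.
all: first [have := e12 b d a | exfalso; lia]; try lia.
all: first [have := e12 d a b | exfalso; lia]; try lia.
all: first [have := e12 d b a | exfalso; lia]; try lia.
Qed.

(** The right-hand side comes from the coefficients of h_k^3. *)
Lemma kostka_coef_symmetrize k a b d : (a + b + d = 3 * k)%N ->
  sum_perm3 (fun a b d => kostka_coef a.+2 b.+1 d) a b d =
  sum_perm3 (fun a b d => if [&& a == k, b == k & d == k]%N then 1 else 0) a b d.
Proof.
move: a b d; apply: sum_perm3_sorted => p q d; rewrite /sum_perm3 /kostka_coef /alternating_extension.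
(* For a gap of at most 2, adding (2,1,0) to a permuted triple can create ties or reverse an order,
   so these cases are separated from the generic one. *)
case: p => [|[|[|p]]]; case: q => [|[|[|q]]] => dpqk; try lia.
all: decide_ifs; rewrite /min_gap; try lia.
Qed.

(** The right-hand side comes from the coefficients of h_k p_2[h_k], in the form given by
    [complete_power2]. *)
Lemma sign_coef_symmetrize k a b d : (a + b + d = 3 * k)%N ->
  sum_perm3 (fun a b d => sign_coef a.+2 b.+1 d) a b d =
  sum_perm3 (fun a b d => if a == k then if odd b then -1 else 1 else 0) a b d.
Proof.
move: a b d; apply: sum_perm3_sorted => p q d; rewrite /sum_perm3 /sign_coef /alternating_extension.
case: p => [|[|[|p]]]; case: q => [|[|[|q]]] => dpqk; try lia.
all: decide_ifs; rewrite /min_gap; try lia.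
all: try case: (ltngtP p q) => pq.
all: case: (boolP (odd d)) => od; try case: (boolP (odd p)) => op; try case: (boolP (odd q)) => oq.
all: try solve [exfalso; lia].
all: decide_ifs.
all: try lia.
Qed.

(** * Evaluation of the three sums of Jacobi-Trudi determinants *)

Section JacobiTrudiSums.
Variables (R : idomainType) (y : nat -> R) (n k B : nat).
Hypotheses (nz6 : 6%:R != 0 :> R) (ltkB : (3 * k + 3 < B)%N).

(** With b = l + (2,1,0), the strictly decreasing triples b of total 3k + 3 are the partitions l of
    3k with at most three parts. *)
Definition jacobi_trudi_sum (c : nat -> nat -> nat -> int) : R :=
  triple_sum B (3 * k + 3) (fun b1 b2 b3 => if (b3 < b2 < b1)%N
    then (c b1 b2 b3)%:~R * jacobi_trudi y n b1 b2 b3 else 0).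

Lemma jacobi_trudi_sum_complete c : antisymmetric3 c ->
  jacobi_trudi_sum c = triple_sum B (3 * k) (fun a b d =>
    (c a.+2 b.+1 d)%:~R * (complete y n a * complete y n b * complete y n d)).
Proof.
move=> anti_c; rewrite /jacobi_trudi_sum -triple_sum_antisymmetric // addn3.
by rewrite triple_sum_scomplete // -addn3.
Qed.

Lemma jacobi_trudi_sum_kostka : jacobi_trudi_sum kostka_coef = complete y n k ^+ 3.
Proof.
rewrite jacobi_trudi_sum_complete; last exact: alternating_extension_antisymmetric.
have := triple_sum_symmetrize y n B nz6 (@kostka_coef_symmetrize k) => /= ->.
have -> : (3 * k = k + k + k)%N by lia.
have /= eD := @triple_sum_delta _ B k k k
  (fun a b d => complete y n a * complete y n b * complete y n d).
rewrite (_ : _ ^+ 3 = complete y n k * complete y n k * complete y n k); last ring.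
rewrite -eD; try lia.
by apply: eq_triple_sum => a b d _; case: ifP; rewrite ?mul1r ?mul0r.
Qed.

Lemma jacobi_trudi_sum_sign :
  jacobi_trudi_sum sign_coef = complete y n k * complete (fun i => y i ^+ 2) n k.
Proof.
rewrite jacobi_trudi_sum_complete; last exact: alternating_extension_antisymmetric.
have := triple_sum_symmetrize y n B nz6 (@sign_coef_symmetrize k) => /= ->.
rewrite -(@complete_power2 _ _ B n k k); last lia.
rewrite -triple_sumZ -mulSnr; apply: eq_triple_sum => a b d _.
case: eqP => [->|_]; last by rewrite !mul0r mulr0.
by rewrite -[(-1) ^+ b]signr_odd; case: (odd b); rewrite ?expr0 ?expr1 /=; ring.
Qed.

Lemma jacobi_trudi_sum_sgn_mod3 :
  jacobi_trudi_sum sgn_mod3 = complete (fun i => y i ^+ 3) n k.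
Proof.
rewrite jacobi_trudi_sum_complete; last exact: sgn_mod3_antisymmetric.
by rewrite complete_power3 //; clear -ltkB; lia.
Qed.

End JacobiTrudiSums.

(** * Semistandard tableaux with at most three rows, enumerated by branching *)

Definition row_of (n l : nat) (r : seq nat) : bool :=
  [&& size r == l, sorted leq r & all (fun e => 0 < e <= n)%N r].

Lemma row_aboveP r s :
  reflect ((size s <= size r)%N /\
           forall j, (j < size s)%N -> (nth 0 r j < nth 0 s j)%N) (row_above r s).
Proof.
apply: (iffP andP) => -[le_sr H]; split=> //.
  by move=> j ltj; apply: (allP H); rewrite mem_iota.
by apply/allP => j; rewrite mem_iota => /andP[_]; apply: H.
Qed.

Lemma sorted_cat_nseq r d e : all (fun x => x <= e)%N r ->
  sorted leq (r ++ nseq d e) = sorted leq r.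
Proof.
move=> le_re; rewrite !(sorted_pairwise leq_trans) pairwise_cat.
have -> : pairwise leq (nseq d e).
  elim: d => //= d ->; rewrite andbT; apply/allP => x /nseqP[-> _]; exact: leqnn.
rewrite andbT andb_idl // => _; apply/allrelP => x z xr /nseqP[-> _].
exact: (allP le_re).
Qed.

Lemma row_of_cat_nseq n l d r : row_of n l r -> row_of n.+1 (l + d) (r ++ nseq d n.+1).
Proof.
case/and3P=> /eqP sz_r so_r al_r; apply/and3P; split.
- by rewrite size_cat size_nseq sz_r.
- rewrite sorted_cat_nseq //; apply: sub_all al_r => x; lia.
rewrite all_cat (@sub_all _ _ _ _ _ al_r) /=; last by move=> x; lia.
by apply/allP => x /nseqP[-> _]; rewrite ltnS leqnn.
Qed.

Lemma row_of_split n l r : row_of n.+1 l r ->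
  exists2 r', row_of n (size r') r' & r = r' ++ nseq (l - size r') n.+1 /\ (size r' <= l)%N.
Proof.
case/and3P=> /eqP sz_r so_r al_r; exists [seq e <- r | (e <= n)%N].
  apply/and3P; split=> //; first exact: (sorted_filter leq_trans).
  apply/allP => x; rewrite mem_filter => /andP[le_xn /(allP al_r)]; lia.
split; last by rewrite -sz_r size_filter count_size.
set r' := filter _ r; have le_r' : all (fun x => x <= n.+1)%N r'.
  by apply/allP => x; rewrite mem_filter; lia.
apply: (sorted_eq leq_trans anti_leq) => //.
  by rewrite sorted_cat_nseq // (sorted_filter leq_trans).
rewrite -(perm_filterC (fun e => (e <= n)%N) r) perm_cat2l -/r'.
suff -> : filter (predC (fun e => (e <= n)%N)) r = nseq (l - size r') n.+1 by [].
have -> : (l - size r' = size (filter (predC (fun e => (e <= n)%N)) r))%N.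
  rewrite -sz_r /r' !size_filter -(count_predC (fun e => (e <= n)%N) r) addKn //.
apply/all_pred1P/allP => x; rewrite mem_filter /= => /andP[lt_nx /(allP al_r)]; lia.
Qed.

(** Two entries n + 1 cannot share a column, so the whole lower row must lie below the entries at
    most n of the upper one, where an n + 1 is always allowed. This is the interlacing condition. *)
Lemma row_above_cat_nseq n r s a b :
  row_of n (size r) r -> row_of n (size s) s ->
  row_above (r ++ nseq a n.+1) (s ++ nseq b n.+1) =
  (size s + b <= size r)%N && row_above r s.
Proof.
move=> /and3P[_ _ al_r] /and3P[_ _ al_s].
have ltr j : (j < size r)%N -> (nth 0 r j <= n)%N.
  by move=> ltj; case/andP: (allP al_r _ (mem_nth 0%N ltj)).
apply/row_aboveP/andP; rewrite !size_cat !size_nseq => -[le_sr above].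
  have le_sbr : (size s + b <= size r)%N.
    rewrite leqNgt; apply/negP => lt_rsb; have := above _ lt_rsb.
    rewrite !nth_cat ltnn subnn nth_nseq ifT; last lia.
    case: ifP => lt_rs; first by have /andP[] := allP al_s _ (mem_nth 0%N lt_rs) => _ /leqW; rewrite leqNgt => /negbTE->.
    by rewrite nth_nseq; case: ifP; rewrite ?ltnn.
  split=> //; apply/row_aboveP; split; first lia.
  move=> j lt_js; have lt_jr : (j < size r)%N by lia.
  by have := above j; rewrite !nth_cat lt_js lt_jr; apply; exact: leq_trans (leq_addr _ _).
case/row_aboveP: above => le_s above; split; first lia.
move=> j ltj; rewrite !nth_cat (leq_trans ltj le_sr) nth_nseq.
case: ifP => [/above // | ge_js]; rewrite ifT; last lia.
by rewrite ltnS ltr //; lia.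
Qed.

(** Always three rows, possibly empty, so that all shapes are treated uniformly. *)
Definition rows3 : Type := seq nat * seq nat * seq nat.

Definition ssyt3 n l1 l2 l3 (t : rows3) : bool :=
  let: (r1, r2, r3) := t in
  [&& row_of n l1 r1, row_of n l2 r2, row_of n l3 r3, row_above r1 r2 & row_above r2 r3].

Definition extend3 e d1 d2 d3 (t : rows3) : rows3 :=
  let: (r1, r2, r3) := t in (r1 ++ nseq d1 e, r2 ++ nseq d2 e, r3 ++ nseq d3 e).

(** The shapes left when the cells containing the largest entry are removed; the ranges are those of
    [jacobi_trudi_branching]. *)
Definition interlacing3 l1 l2 l3 : seq (nat * nat * nat) :=
  [seq (m12, m3) | m12 <- [seq (m1, m2) | m1 <- index_iota l2 l1.+1, m2 <- index_iota l3 l2.+1],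
                   m3 <- index_iota 0 l3.+1].

Fixpoint ssyt3_seq n l1 l2 l3 : seq rows3 :=
  if n is n'.+1 then
    [seq extend3 n (l1 - m.1.1) (l2 - m.1.2) (l3 - m.2) t
       | m <- interlacing3 l1 l2 l3, t <- ssyt3_seq n' m.1.1 m.1.2 m.2]
  else if [&& l1 == 0, l2 == 0 & l3 == 0]%N then [:: ([::], [::], [::])] else [::].

Lemma mem_interlacing3 l1 l2 l3 m1 m2 m3 :
  ((m1, m2, m3) \in interlacing3 l1 l2 l3) = [&& l2 <= m1 <= l1, l3 <= m2 <= l2 & m3 <= l3]%N.
Proof.
apply/allpairsP/idP => [[[[m1' m2'] m3'] [/allpairsP[[m1'' m2''] /=]]]|].
  by rewrite !mem_index_iota => -[H1 H2 [-> ->]] H3 [-> -> ->]; lia.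
move=> H; exists ((m1, m2), m3); split=> //=; last by rewrite mem_index_iota; lia.
by apply/allpairsP; exists (m1, m2); rewrite !mem_index_iota; split=> //=; lia.
Qed.

Lemma mem_ssyt3_seq n l1 l2 l3 t : (l3 <= l2 <= l1)%N ->
  (t \in ssyt3_seq n l1 l2 l3) = ssyt3 n l1 l2 l3 t.
Proof.
elim: n l1 l2 l3 t => [|n IHn] l1 l2 l3 [[r1 r2] r3] le_l /=.
  apply/idP/idP => [|/and5P[]].
    by case: ifP => // /and3P[/eqP-> /eqP-> /eqP->]; rewrite inE => /eqP[-> -> ->].
  have row0 l r : row_of 0 l r -> l = 0%N /\ r = [::].
    by case: r => [/and3P[/eqP<-]//|x r /and3P[_ _ /= /andP[]]]; lia.
  by move=> /row0[-> ->] /row0[-> ->] /row0[-> ->]; rewrite inE.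
apply/allpairsPdep/idP => [[[[m1 m2] m3] [[[r1' r2'] r3'] []]]|].
  rewrite mem_interlacing3 /= => mP; rewrite IHn; last lia.
  case/and5P=> r1P r2P r3P r12 r23 [-> -> ->].
  have [s1 s2 s3] : [/\ size r1' = m1, size r2' = m2 & size r3' = m3].
    by move: r1P r2P r3P => /and3P[/eqP-> _ _] /and3P[/eqP-> _ _] /and3P[/eqP-> _ _].
  have := row_of_cat_nseq (l1 - m1) r1P; rewrite subnKC; last lia.
  have := row_of_cat_nseq (l2 - m2) r2P; rewrite subnKC; last lia.
  have := row_of_cat_nseq (l3 - m3) r3P; rewrite subnKC; last lia.
  move=> -> -> -> /=; rewrite !row_above_cat_nseq ?s1 ?s2 ?s3 // r12 r23; lia.
case/and5P=> /row_of_split[r1' r1P [-> le1]] /row_of_split[r2' r2P [-> le2]].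
case/row_of_split=> [r3' r3P [-> le3]].
rewrite !row_above_cat_nseq // => /andP[le21 r12] /andP[le32 r23].
exists ((size r1', size r2'), size r3'), (r1', r2', r3'); split=> //.
  by rewrite mem_interlacing3; lia.
by rewrite IHn /= ?r1P ?r2P ?r3P ?r12 //; lia.
Qed.

Lemma ssyt3_seq_uniq n l1 l2 l3 : (l3 <= l2 <= l1)%N -> uniq (ssyt3_seq n l1 l2 l3).
Proof.
elim: n l1 l2 l3 => [|n IHn] l1 l2 l3 le_l /=; first by case: ifP.
apply: allpairs_uniq_dep.
- apply: allpairs_uniq; rewrite ?iota_uniq //; last by move=> [? ?] [? ?].
  by apply: allpairs_uniq; rewrite ?iota_uniq //; move=> [? ?] [? ?].
- by move=> [[m1 m2] m3]; rewrite mem_interlacing3 => mP; apply: IHn => /=; lia.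
move=> t t' /allpairsPdep[[[m1 m2] m3] [[[r1 r2] r3] [/= mP tP ->]]].
move=> /allpairsPdep[[[m1' m2'] m3'] [[[r1' r2'] r3'] [/= mP' tP' ->]]] /= [e1 e2 e3].
rewrite mem_interlacing3 in mP; rewrite mem_interlacing3 in mP'.
rewrite mem_ssyt3_seq in tP; last lia. rewrite mem_ssyt3_seq in tP'; last lia.
(* Filtering out n + 1 recovers the shorter row, hence both the smaller tableau and its shape. *)
have cut m m' d d' r r' : row_of n m r -> row_of n m' r' ->
    r ++ nseq d n.+1 = r' ++ nseq d' n.+1 -> r = r' /\ m = m'.
  have filt m0 d0 r0 : row_of n m0 r0 -> filter (fun x => x <= n)%N (r0 ++ nseq d0 n.+1) = r0.
    case/and3P=> _ _ al; rewrite filter_cat filter_nseq ltnn cats0; apply/all_filterP.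
    by apply: sub_all al => x /andP[].
  move=> rP rP' e; have err' : r = r' by rewrite -(filt _ d _ rP) e (filt _ _ _ rP').
  by move: rP rP'; rewrite err' => /and3P[/eqP<- _ _] /and3P[/eqP<- _ _].
case/and5P: tP => r1P r2P r3P _ _; case/and5P: tP' => r1P' r2P' r3P' _ _.
have [-> ->] := cut _ _ _ _ _ _ r1P r1P' e1.
have [-> ->] := cut _ _ _ _ _ _ r2P r2P' e2.
by have [-> ->] := cut _ _ _ _ _ _ r3P r3P' e3.
Qed.

Section Weights.
Variables (R : comNzRingType) (y : nat -> R).

Definition row_weight (r : seq nat) : R := \prod_(e <- r) y e.

Definition rows3_weight (t : rows3) : R :=
  row_weight t.1.1 * row_weight t.1.2 * row_weight t.2.

Lemma row_weight_cat_nseq r d e : row_weight (r ++ nseq d e) = row_weight r * y e ^+ d.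
Proof. by rewrite /row_weight big_cat big_nseq iter_mulr mulr1. Qed.

(** Both sides satisfy the same branching recursion in the number of variables. *)
Lemma sum_ssyt3_weight n l1 l2 l3 : (l3 <= l2 <= l1)%N ->
  \sum_(t <- ssyt3_seq n l1 l2 l3) rows3_weight t = jacobi_trudi y n l1.+2 l2.+1 l3.
Proof.
elim: n l1 l2 l3 => [|n IHn] l1 l2 l3 le_l.
  rewrite /jacobi_trudi /scomplete /complete /=.
  case: l1 l2 l3 le_l => [|l1] [|l2] [|l3] //= _; rewrite ?big_nil ?big_seq1; try ring.
  by rewrite /rows3_weight /row_weight !big_nil; ring.
rewrite jacobi_trudi_branching // /= big_allpairs_dep /= big_allpairs_dep /= big_allpairs_dep /=.
rewrite !big_nat; apply: eq_bigr => m1 m1P; rewrite !big_nat; apply: eq_bigr => m2 m2P.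
rewrite !big_nat; apply: eq_bigr => m3 m3P; rewrite -IHn; last lia.
rewrite !mulr_sumr; apply: eq_bigr => -[[r1 r2] r3] _.
rewrite /rows3_weight /= !row_weight_cat_nseq; ring.
Qed.

End Weights.

(** * Passing between triples of rows, tableaux and fillings; the Jacobi-Trudi formula *)

Definition tableau_of_rows3 (t : rows3) : tableau :=
  [seq r <- [:: t.1.1; t.1.2; t.2] | r != [::]].

Definition rows3_of_tableau (T : tableau) : rows3 :=
  (nth [::] T 0, nth [::] T 1, nth [::] T 2).

Definition partition3 (l1 l2 l3 : nat) : seq nat :=
  [seq l <- [:: l1; l2; l3] | l != 0%N].

Definition entries_le (n : nat) (T : tableau) : bool :=
  all (all (fun e => 0 < e <= n)%N) T.

Lemma rows3_of_tableauK T : (size T <= 3)%N -> all (fun r => r != [::]) T ->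
  tableau_of_rows3 (rows3_of_tableau T) = T.
Proof.
case: T => [|r1 [|r2 [|r3 [|//]]]] //= _; rewrite /tableau_of_rows3 /=.
- by case/andP=> ->.
- by case/and3P=> -> ->.
by case/and4P=> -> -> ->.
Qed.

Lemma ssyt3_rows3_of_tableau n T : (size T <= 3)%N -> semistandard T -> entries_le n T ->
  let t := rows3_of_tableau T in ssyt3 n (size t.1.1) (size t.1.2) (size t.2) t.
Proof.
case: T => [|r1 [|r2 [|r3 [|//]]]] //= _; rewrite /semistandard /entries_le /row_of /= ?eqxx /=.
- by rewrite !andbT => /andP[_ ->] ->.
- by rewrite !andbT => /and3P[_ /andP[-> ->] ->] /andP[-> ->].
by rewrite !andbT => /and3P[_ /and3P[-> -> ->] ->] /and3P[-> -> ->].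
Qed.

Lemma ssyt3_size n l1 l2 l3 t : ssyt3 n l1 l2 l3 t ->
  [/\ size t.1.1 = l1, size t.1.2 = l2 & size t.2 = l3] /\ (l3 <= l2 <= l1)%N.
Proof.
case: t => [[r1 r2] r3] /and5P[/and3P[/eqP <- _ _] /and3P[/eqP <- _ _] /and3P[/eqP <- _ _]].
by move=> /row_aboveP[le21 _] /row_aboveP[le32 _]; split; rewrite ?le32.
Qed.

Lemma tableau_of_rows3K n l1 l2 l3 t : ssyt3 n l1 l2 l3 t ->
  rows3_of_tableau (tableau_of_rows3 t) = t.
Proof.
move/ssyt3_size=> [[]]; case: t => [[r1 r2] r3] /= <- <- <-.
by case: r1 r2 r3 => [|? ?] [|? ?] [|? ?] //=; rewrite ?andbF.
Qed.

Lemma shape_tableau_of_rows3 (t : rows3) :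
  shape (tableau_of_rows3 t) = partition3 (size t.1.1) (size t.1.2) (size t.2).
Proof. by case: t => [[[|? ?] [|? ?]] [|? ?]]. Qed.

Lemma semistandard_tableau_of_rows3 n l1 l2 l3 t : ssyt3 n l1 l2 l3 t ->
  semistandard (tableau_of_rows3 t) && entries_le n (tableau_of_rows3 t).
Proof.
move=> tP; have [[s1 s2 s3] le_l] := ssyt3_size tP; move: tP s1 s2 s3.
case: t => [[r1 r2] r3] /= /and5P[/and3P[_ so1 al1] /and3P[_ so2 al2] /and3P[_ so3 al3] r12 r23].
move=> s1 s2 s3; rewrite -s1 -s2 -s3 in le_l.
apply/andP; split; last first.
  by apply/allP => r; rewrite mem_filter => /andP[_]; rewrite !inE => /or3P[]/eqP->.
apply/and3P; split.
- exact: filter_all.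
- by apply/allP => r; rewrite mem_filter => /andP[_]; rewrite !inE => /or3P[]/eqP->.
by case: r1 r2 r3 le_l r12 r23 {so1 so2 so3 al1 al2 al3 s1 s2 s3}
  => [|? ?] [|? ?] [|? ?] //= _ -> // ->.
Qed.

Lemma size_le_sumn_shape (T : tableau) : all (fun r => r != [::]) T ->
  (size T <= sumn (shape T))%N /\ all (fun r => size r <= sumn (shape T))%N T.
Proof.
elim: T => //= r T IHT /andP[nr /IHT[szT alT]]; case: r nr => // x r _ /=; split; first lia.
by apply/andP; split; [lia | apply: sub_all alT => r' /=; lia].
Qed.

(** No row is empty, so the number of cells bounds both the number of rows and their lengths, and
    the tableau fits into a [filling]. *)
Lemma tableau_of_surj n N T : semistandard T -> entries_le n T ->
  (sumn (shape T) <= N)%N -> exists S : filling n N, tableau_of S = T.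
Proof.
case/and3P=> /size_le_sumn_shape[szT alT] _ _ enT leN.
have [ss ssE] : exists ss : seq (N.-bseq 'I_n),
    [seq [seq (i : 'I_n).+1 | i <- (r : N.-bseq 'I_n)] | r <- ss] = T.
  have {}alT : all (fun r => size r <= N)%N T by apply: sub_all alT => r /= le_r; lia.
  elim: T {szT leN} enT alT => [|r T IHT]; first by exists [::].
  case/andP=> en_r /IHT{}IHT /andP[le_rN /IHT[ss <-]].
  have [s sE] : exists s : seq 'I_n, [seq (i : 'I_n).+1 | i <- s] = r.
    elim: r en_r {le_rN} => [|e r IHr]; first by exists [::].
    case/andP=> /andP[e_gt0 le_en] /IHr[s <-].
    have lt_en : (e.-1 < n)%N by lia.
    by exists (Ordinal lt_en :: s) => /=; rewrite prednK.
  have sz_s : (size s <= N)%N by rewrite -(size_map (fun i : 'I_n => i.+1)) sE.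
  by exists (Bseq sz_s :: ss) => /=; rewrite sE.
have sz_ss : (size ss <= N)%N.
  by move: szT; rewrite -ssE size_map => /leq_trans; apply; rewrite ssE.
by exists (Bseq sz_ss).
Qed.

Lemma tableau_of_inj n N : injective (@tableau_of n N).
Proof.
move=> S1 S2 eS; apply/val_inj/(inj_map _ eS) => r1 r2 er.
by apply/val_inj/(inj_map _ er) => i1 i2 [/val_inj].
Qed.

Lemma entries_le_tableau_of n N (S : filling n N) : entries_le n (tableau_of S).
Proof.
apply/allP => r /mapP[r' _ ->]; apply/allP => e /mapP[i _ ->].
exact: ltn_ord.
Qed.

(** The variable attached to the entry [e], extended by 0 outside 1..n to a sequence to which
    [complete] applies. *)
Definition mpoly_var (n e : nat) : {mpoly rat[n]} :=
  if e is i.+1 then oapp (fun o : 'I_n => 'X_o) 0 (insub i) else 0.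

Lemma mpoly_varS n (i : 'I_n) : mpoly_var n i.+1 = 'X_i.
Proof. by rewrite /mpoly_var valK. Qed.

Lemma schur_jacobi_trudi n l1 l2 l3 : (l3 <= l2 <= l1)%N ->
  schur (partition3 l1 l2 l3) n = jacobi_trudi (mpoly_var n) n l1.+2 l2.+1 l3.
Proof.
move=> le_l; rewrite -sum_ssyt3_weight //; set la := partition3 _ _ _.
pose G (T : tableau) : {mpoly rat[n]} := \prod_(r <- T) row_weight (mpoly_var n) r.
transitivity (\sum_(T <- [seq tableau_of U | U <- enum (SSYT n la)]) G T).
  rewrite big_map big_enum_cond /=; apply: eq_big => [S|S _]; first by rewrite andbT.
  rewrite /G big_map; apply: eq_bigr => r _; rewrite /row_weight big_map.
  by apply: eq_bigr => i _; rewrite mpoly_varS.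
transitivity (\sum_(T <- [seq tableau_of_rows3 t | t <- ssyt3_seq n l1 l2 l3]) G T).
  (* The encoded fillings and the enumerated row triples give two duplicate-free lists of the same
     tableaux. *)
  apply: perm_big; apply: uniq_perm.
  - by rewrite map_inj_uniq ?enum_uniq //; apply: tableau_of_inj.
  - rewrite map_inj_in_uniq ?ssyt3_seq_uniq // => t t'; rewrite !mem_ssyt3_seq // => tP tP' e.
    by rewrite -(tableau_of_rows3K tP) e (tableau_of_rows3K tP').
  move=> T; apply/mapP/mapP => [[S] | [t]].
    rewrite mem_enum inE => /andP[ssT /eqP shT] eT; rewrite -eT in ssT shT.
    have szT : (size T <= 3)%N.
      by rewrite -(size_map size) -/(shape T) shT; rewrite size_filter; exact: (count_size _ [:: _; _; _]).
    exists (rows3_of_tableau T); last by rewrite rows3_of_tableauK //; case/and3P: ssT.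
    rewrite mem_ssyt3_seq //.
    have tP := @ssyt3_rows3_of_tableau n T szT ssT; rewrite /= in tP.
    have {}tP := tP _; rewrite {1}eT entries_le_tableau_of in tP; have {}tP := tP isT.
    suff [<- <- <-] : [/\ size (nth [::] T 0) = l1, size (nth [::] T 1) = l2
        & size (nth [::] T 2) = l3] by [].
    have shE i : size (nth [::] T i) = nth 0%N la i.
      rewrite -shT /shape; case: (ltnP i (size T)) => lti; first by rewrite (nth_map [::]).
      by rewrite !nth_default ?size_map.
    rewrite !shE /la; move: le_l; case: l1 l2 l3 {la S eT shT shE} => [|?] [|?] [|?] //=; lia.
  rewrite mem_ssyt3_seq // => tP eT; have /andP[ssT enT] := semistandard_tableau_of_rows3 tP.
  have [[s1 s2 s3] _] := ssyt3_size tP.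
  have shT : shape T = la by rewrite eT shape_tableau_of_rows3 s1 s2 s3.
  rewrite -eT in ssT enT; have [|S SE] := tableau_of_surj ssT enT (N := sumn la); first by rewrite shT.
  by exists S; rewrite // mem_enum inE SE ssT shT eqxx.
rewrite big_map; apply: eq_bigr => -[[r1 r2] r3] _.
rewrite /G /tableau_of_rows3 big_filter big_mkcond !big_cons big_nil /= mulr1 mulrA /rows3_weight /=.
have w0 r : (if r != [::] then row_weight (mpoly_var n) r else 1) = row_weight (mpoly_var n) r.
  by case: eqP => //= ->; rewrite /row_weight big_nil.
by rewrite !w0.
Qed.

(** The first column increases strictly from an entry at least 1, so row i, counted from 0, starts
    with an entry larger than i. *)
Lemma size_semistandard n T : semistandard T -> entries_le n T -> (size T <= n)%N.
Proof.
case/and3P=> /allP neT _ /(sortedP [::]) aboveT /allP enT.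
have ne i : (i < size T)%N -> (0 < size (nth [::] T i))%N.
  by move=> /(mem_nth [::]) /neT; case: (nth _ _ _).
have first_col i : (i < size T)%N -> (i < nth 0 (nth [::] T i) 0)%N.
  elim: i => [|i IHi] lti.
    by have /andP[] := allP (enT _ (mem_nth [::] lti)) _ (mem_nth 0%N (ne _ lti)).
  have /row_aboveP[_ above] := aboveT _ lti.
  exact: leq_ltn_trans (IHi (ltnW lti)) (above _ (ne _ lti)).
case sz: (size T) => [//|m]; have ltm : (m < size T)%N by rewrite sz.
have /andP[_] := allP (enT _ (mem_nth [::] ltm)) _ (mem_nth 0%N (ne _ ltm)).
exact: leq_trans (first_col _ ltm).
Qed.

(** * Tableaux of content (k,k,k) and their types *)

(** The rows (l1, l2, l3), (m1, m2), (p) form the Gelfand-Tsetlin pattern of the tableau: the shapes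
    of its parts with entries at most 3, 2 and 1. *)
Lemma ssyt3_3P l1 l2 l3 t :
  reflect (exists p m1 m2, [/\ t = (nseq p 1 ++ nseq (m1 - p) 2 ++ nseq (l1 - m1) 3,
      nseq m2 2 ++ nseq (l2 - m2) 3, nseq l3 3)%N, (m2 <= p <= m1)%N, (m1 <= l1)%N
      & (l3 <= m2)%N && (m2 <= l2 <= m1)%N]) (ssyt3 3 l1 l2 l3 t).
Proof.
apply: (iffP idP) => [tP | [p [m1 [m2 [-> mp ml lm]]]]].
  have le_l := (ssyt3_size tP).2; move: tP; rewrite -mem_ssyt3_seq //.
  move=> /allpairsPdep[[[m1 m2] m3] [t2 [mP /allpairsPdep[[[p1 p2] p3] [t1 [pP]]]]]].
  move=> /allpairsPdep[[[q1 q2] q3] [t0 [qP /= t0P ->]]] -> ->.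
  rewrite !mem_interlacing3 /= in mP pP qP.
  move: t0P; case: ifP => // /and3P[/eqP q10 /eqP q20 /eqP q30]; rewrite inE => /eqP ->.
  exists p1, m1, m2; split; try lia.
  rewrite /= q10 q20 q30 !subn0 -!catA; have [-> [-> ->]] : p2 = 0%N /\ p3 = 0%N /\ m3 = 0%N by lia.
  by rewrite !subn0.
rewrite -mem_ssyt3_seq; last lia.
apply/allpairsPdep; exists (m1, m2, 0%N).
exists (nseq p 1 ++ nseq (m1 - p) 2, nseq m2 2, [::])%N; split.
- by rewrite mem_interlacing3 /=; lia.
- apply/allpairsPdep; exists (p, 0, 0)%N, (nseq p 1, [::], [::])%N; split.
  + by rewrite mem_interlacing3 /=; lia.
  + apply/allpairsPdep; exists (0, 0, 0)%N, ([::], [::], [::]).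
    by split; [rewrite mem_interlacing3 | | rewrite /= subn0].
  + by rewrite /= !subn0.
by rewrite /= !subn0 -catA.
Qed.

Lemma flatten_nonempty (T : eqType) (s : seq (seq T)) :
  flatten [seq r <- s | r != [::]] = flatten s.
Proof. by elim: s => //= r s IHs; case: eqP => [->|_] /=; rewrite IHs. Qed.

(* After removal of its [m] columns of height 3, the second row of this tableau
   has [j] cells, [i] of which contain 2. *)
Definition kkk_rows (k m j i : nat) : rows3 :=
  (nseq k 1 ++ nseq (k - m - i) 2 ++ nseq (k - m - (j - i)) 3,
   nseq (m + i) 2 ++ nseq (j - i) 3, nseq m 3)%N.

(** The second condition says that row 2 has at most the k - m entries 3 left over by row 3; the
    third is m + j <= k + (k - m - i), so that row 2 lies below entries 1 and 2 of row 1. *)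
Definition kkk_cond (k m j i : nat) : bool :=
  [&& i <= j, j <= i + (k - m) & i + j <= 2 * (k - m)]%N.

Lemma kkk_rows_perm k m j i : (m <= k)%N -> kkk_cond k m j i ->
  perm_eq (flatten (tableau_of_rows3 (kkk_rows k m j i))) (nseq k 1 ++ nseq k 2 ++ nseq k 3)%N.
Proof.
move=> le_mk /and3P[le_ij le_j le_i2].
apply/permP => a; rewrite flatten_nonempty /= cats0 !count_cat !count_nseq.
case: (a 1%N); case: (a 2%N); case: (a 3%N); lia.
Qed.

Lemma ssyt3_kkk_rows k m j i : (m <= k)%N -> kkk_cond k m j i ->
  ssyt3 3 (3 * k - 2 * m - j) (m + j) m (kkk_rows k m j i).
Proof.
move=> le_mk /and3P[le_ij le_j le_i2]; apply/ssyt3_3P.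
exists k, (k + (k - m - i))%N, (m + i)%N; split; try lia.
rewrite /kkk_rows; congr (_ ++ (nseq _ _ ++ nseq _ _), _ ++ nseq _ _, _); lia.
Qed.

Lemma kkk_rows_surj k l1 l2 l3 t : ssyt3 3 l1 l2 l3 t ->
  perm_eq (flatten (tableau_of_rows3 t)) (nseq k 1 ++ nseq k 2 ++ nseq k 3)%N ->
  exists j i, [/\ t = kkk_rows k l3 j i, (l3 <= k)%N, kkk_cond k l3 j i, l2 = (l3 + j)%N
    & (l1 + l2 + l3 = 3 * k)%N].
Proof.
case/ssyt3_3P=> p [m1 [m2 [-> mp ml lm]]]; rewrite flatten_nonempty /= cats0 => /permP cnt.
have := (cnt (pred1 1), cnt (pred1 2), cnt (pred1 3))%N.
rewrite !count_cat !count_nseq /= => -[[c1 c2] c3].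
exists (l2 - l3)%N, (m2 - l3)%N; rewrite /kkk_cond; split; try lia.
rewrite /kkk_rows; congr (nseq _ _ ++ (nseq _ _ ++ nseq _ _), nseq _ _ ++ nseq _ _, _); lia.
Qed.

Definition two_row_type_of_counts (N2 N3 : nat) : tableau :=
  if (2 * N2 <= N3)%N && (N3 != 2 * N2 + 1)%N
  then if odd N2 then T_d else T_a
  else if odd N2 then T_c else T_b.

(** Removing a column of height 3 lowers [k] and [m] by one, keeps [j] and [i], and costs one
    transposition; after m removals the two-row rule applies with N_2 = i and N_3 = j - i. *)
Lemma type_of_kkk_rows k m j i : (m <= k)%N -> kkk_cond k m j i ->
  type_of k (tableau_of_rows3 (kkk_rows k m j i)) =
  iter m transpose (two_row_type_of_counts i (j - i)).
Proof.
elim: m k => [|m IHm] k le_mk /and3P[le_ij le_j le_i2].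
  (* For k = 1 the type is the standard tableau itself; in the three possible cases this agrees with
     the two-row rule. *)
  rewrite [iter _ _ _]/=; have [k1 | k1] := eqVneq k 1%N.
    rewrite k1 in le_j le_i2 *.
    by case: i j le_ij le_j le_i2 => [|[|i]] [|[|j]] //=; lia.
  have -> : type_of k (tableau_of_rows3 (kkk_rows k 0 j i)) =
      two_row_type (tableau_of_rows3 (kkk_rows k 0 j i)).
    have sz2 : (size (tableau_of_rows3 (kkk_rows k 0 j i)) <= 2)%N.
      rewrite size_filter; exact: (count_size _ [:: _; _]).
    by case: k k1 {le_mk le_j le_i2} sz2 => [|k] k1 sz2; rewrite /type_of ?(negPf k1) sz2.
  have row2 e : row2_count e (tableau_of_rows3 (kkk_rows k 0 j i)) =
      count_mem e (nseq i 2 ++ nseq (j - i) 3)%N.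
    rewrite /row2_count; congr (count_mem e _).
    case: k k1 {le_mk} le_j le_i2 => [|k] k1 le_j le_i2.
      by have -> : i = 0%N by [lia]; have -> : j = 0%N by lia.
    by rewrite /tableau_of_rows3 /= add0n; case: eqP => [->|].
  rewrite /two_row_type !row2 !count_cat !count_nseq /= mul0n mul1n mul0n mul1n addn0 add0n.
  by [].
case: k le_mk le_j le_i2 => [//|k] le_mk le_j le_i2.
have [k1 | k1] := eqVneq k.+1 1%N.
  have [-> [-> [-> ->]]] : k = 0%N /\ m = 0%N /\ i = 0%N /\ j = 0%N by lia.
  by [].
rewrite iterS -(IHm k) //; first by rewrite [LHS]/= (negPf k1) /= /kkk_rows !subSS.
by apply/and3P; split=> //; rewrite -(subSS m).
Qed.

(** For m <= k, the number of tableaux of type [T] with shape (3k - 2m - j, m + j, m). *)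
Definition type_count (k m j : nat) (T : tableau) : nat :=
  \sum_(0 <= i < j.+1)
     (kkk_cond k m j i && (iter m transpose (two_row_type_of_counts i (j - i)) == T)).

Lemma sum_SSYTkkk (R : comNzRingType) (G : seq nat -> R) (k B : nat) (T : tableau) :
  (3 * k + 3 < B)%N ->
  \sum_(S in SSYTkkk k | type_of k (tableau_of S) == T) G (shape (tableau_of S)) =
  triple_sum B (3 * k + 3) (fun b1 b2 b3 => if (b3 < b2 < b1)%N
    then G (partition3 (b1 - 2) (b2 - 1) b3) *+ type_count k b3 (b2 - b3 - 1) T else 0).
Proof.
move=> ltkB.
(* A tableau is indexed by its shifted shape b = l + (2,1,0) and the number [i]; then m = b3 and j =
   b2 - b3 - 1. *)
pose idx := [seq (b, i) | b <- [seq (b12, b3) | b12 <- [seq (b1, b2) | b1 <- index_iota 0 B,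
     b2 <- index_iota 0 B], b3 <- index_iota 0 B], i <- index_iota 0 (b.1.2 - b.2)].
pose good (q : nat * nat * nat * nat) := let: (b1, b2, b3, i) := q in
  [&& (b1 + b2 + b3 == 3 * k + 3), (b3 < b2 < b1) & kkk_cond k b3 (b2 - b3 - 1) i]%N.
pose tab (q : nat * nat * nat * nat) := let: (b1, b2, b3, i) := q in
  kkk_rows k b3 (b2 - b3 - 1) i.
have goodP b1 b2 b3 i : good (b1, b2, b3, i) -> [/\ (b3 <= k)%N,
    kkk_cond k b3 (b2 - b3 - 1) i &
    ssyt3 3 (b1 - 2) (b2 - 1) b3 (tab (b1, b2, b3, i))].
  rewrite /good => /and3P[/eqP sb ltb cond]; have le_k : (b3 <= k)%N by lia.
  split=> //; have := ssyt3_kkk_rows le_k cond.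
  by congr (ssyt3 _ _ _ _ _); lia.
have mem_idx b1 b2 b3 i : ((b1, b2, b3, i) \in idx) =
    [&& b1 < B, b2 < B, b3 < B & i < b2 - b3]%N.
  apply/allpairsPdep/idP => [[[[b1' b2'] b3'] [i' [/allpairsP[[[b1'' b2''] b3''] /= [/allpairsP[[x1 x2] /= []]]]]]]|].
    rewrite !mem_index_iota => ? ? [-> ->] ? [-> -> ->] ? [-> -> -> ->]; lia.
  move=> /and4P[? ? ? ?]; exists (b1, b2, b3), i; split=> //; last by rewrite mem_index_iota.
  apply/allpairsP; exists ((b1, b2), b3); split=> //=; last by rewrite mem_index_iota.
  by apply/allpairsP; exists (b1, b2); rewrite !mem_index_iota.
transitivity (\sum_(U <- [seq tableau_of S0 | S0 <- enum (SSYTkkk k)] | type_of k U == T) G (shape U)).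
  by rewrite big_map big_enum_cond.
transitivity (\sum_(U <- [seq tableau_of_rows3 (tab q) | q <- idx & good q] | type_of k U == T) G (shape U)).
  apply: perm_big; apply: uniq_perm.
  - by rewrite map_inj_uniq ?enum_uniq //; apply: tableau_of_inj.
  - rewrite map_inj_in_uniq ?filter_uniq //.
      apply: allpairs_uniq_dep.
      + apply: allpairs_uniq; rewrite ?iota_uniq //; last by move=> [? ?] [? ?].
        by apply: allpairs_uniq; rewrite ?iota_uniq //; move=> [? ?] [? ?].
      + by move=> ? _; apply: iota_uniq.
      + by move=> [[[? ?] ?] ?] [[[? ?] ?] ?] /= _ _ [-> -> -> ->].
    move=> [[[b1 b2] b3] i] [[[b1' b2'] b3'] i']; rewrite !mem_filter => /andP[qg _] /andP[qg' _] e.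
    have [_ _ qP] := goodP _ _ _ _ qg; have [_ _ qP'] := goodP _ _ _ _ qg'.
    have et : tab (b1, b2, b3, i) = tab (b1', b2', b3', i').
      by rewrite -(tableau_of_rows3K qP) e (tableau_of_rows3K qP').
    have [[s1 s2 s3] _] := ssyt3_size qP; have [[s1' s2' s3'] _] := ssyt3_size qP'.
    (* The shape gives back b1, b2, b3, and the number b3 + i of entries 2 in row 2 gives back i. *)
    rewrite et in s1 s2 s3; case: et => _ /(congr1 (count_mem 2%N)).
    rewrite !count_cat !count_nseq /= => ei _.
    rewrite /good in qg qg'.
    have [-> [-> [-> ->]]] : b1 = b1' :> nat /\ b2 = b2' :> nat /\ b3 = b3' :> nat /\ i = i' :> nat.
      have e1 : (b1 - 2 = b1' - 2)%N by exact: etrans (esym s1) s1'.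
      have e2 : (b2 - 1 = b2' - 1)%N by exact: etrans (esym s2) s2'.
      have e3 : b3 = b3' by exact: etrans (esym s3) s3'.
      lia.
    by [].
  move=> U; apply/mapP/mapP => [[S0] | [[[[b1 b2] b3] i]]].
    rewrite mem_enum inE => /andP[ssU peU] eU; rewrite -eU in ssU peU.
    have enU : entries_le 3 U by rewrite eU entries_le_tableau_of.
    have szU := size_semistandard ssU enU.
    have tP : ssyt3 3 (size (nth [::] U 0)) (size (nth [::] U 1)) (size (nth [::] U 2))
      (rows3_of_tableau U) := ssyt3_rows3_of_tableau szU ssU enU.
    have tK : tableau_of_rows3 (rows3_of_tableau U) = U.
      by apply: rows3_of_tableauK => //; case/and3P: ssU.
    rewrite -tK in peU; have [j [i [et le3 cond e2 e1]]] := kkk_rows_surj tP peU.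
    have [_ le_l] := ssyt3_size tP.
    move: tP et le3 cond e2 e1 le_l; set l1 := size _; set l2 := size _; set l3 := size _.
    move=> tP et le3 cond e2 e1 le_l.
    exists (l1 + 2, l2 + 1, l3, i)%N.
      have ej : (l2 + 1 - l3 - 1 = j)%N by lia.
      rewrite mem_filter mem_idx /good ej cond; move: cond => /and3P[? ? ?]; lia.
    rewrite -tK et /tab; congr (tableau_of_rows3 (kkk_rows _ _ _ _)); lia.
  rewrite mem_filter => /andP[qg _] ->; have [le3 cond qP] := goodP _ _ _ _ qg.
  have /andP[ssU enU] := semistandard_tableau_of_rows3 qP.
  have peU := kkk_rows_perm le3 cond.
  have [|S0 S0E] := tableau_of_surj ssU enU (N := (3 * k)%N).
    by rewrite -size_flatten (perm_size peU) !size_cat !size_nseq; lia.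
  by exists S0; rewrite // mem_enum inE S0E ssU.
rewrite big_map big_filter_cond big_mkcond big_allpairs_dep /= big_allpairs_dep /= big_allpairs_dep /=.
rewrite /triple_sum; apply: eq_bigr => b1 _; apply: eq_bigr => b2 _; apply: eq_bigr => b3 _.
rewrite -big_mkcond /=.
have [sb | nsb] := boolP (b1 + b2 + b3 == 3 * k + 3)%N; last by rewrite big_pred0.
have [ltb | nltb] := boolP (b3 < b2 < b1)%N; last by rewrite big_pred0.
set j := (b2 - b3 - 1)%N; have -> : (b2 - b3 = j.+1)%N by rewrite /j; lia.
rewrite /type_count -sumrMnr big_mkcond; apply: eq_big_nat => i lti /=.
case cond: kkk_cond => //=.
have [|le3 _ qP] := goodP b1 b2 b3 i; first by rewrite /good sb ltb.
rewrite type_of_kkk_rows //; case: eqP => // _.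
rewrite shape_tableau_of_rows3; by have [[-> -> ->] _] := ssyt3_size qP.
Qed.

(** * Counting the tableaux of each type for a fixed shape *)

Lemma iter_transpose m T U : T \in [:: T_a; T_b; T_c; T_d] ->
  U \in [:: T_a; T_b; T_c; T_d] ->
  (iter m transpose U == T) = (U == if odd m then transpose T else T).
Proof.
move=> hT hU; have trK V : V \in [:: T_a; T_b; T_c; T_d] -> transpose (transpose V) = V.
  by rewrite !inE => /or4P[]/eqP->.
have iterE : iter m transpose U = if odd m then transpose U else U.
  by elim: m => //= m ->; case: (odd m) => //=; rewrite trK.
rewrite iterE; case: (odd m) => //.
by apply/eqP/eqP => [<-|->]; rewrite trK.
Qed.

(** [w./2] counts the odd numbers below [w]; in the next lemma [uphalf w] counts the even ones. *)
Lemma sum_odd_interval N u v : (u <= v <= N)%N ->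
  (\sum_(0 <= i < N) ((u <= i < v) && odd i) = v./2 - u./2)%N.
Proof.
case/andP=> uv vN; have -> : (v./2 - u./2 = (minn N v)./2 - (minn N u)./2)%N by lia.
elim: N {vN} => [|N IHN]; first by rewrite big_nil; lia.
by rewrite big_nat_recr //= IHN; case: (boolP (odd N)) => oN; case: (leqP u N) => leuN;
  case: (ltnP N v) => ltNv /=; lia.
Qed.

Lemma sum_even_interval N u v : (u <= v <= N)%N ->
  (\sum_(0 <= i < N) ((u <= i < v) && ~~ odd i) = uphalf v - uphalf u)%N.
Proof.
case/andP=> uv vN.
have -> : (uphalf v - uphalf u = uphalf (minn N v) - uphalf (minn N u))%N by lia.
elim: N {vN} => [|N IHN]; first by rewrite big_nil; lia.
by rewrite big_nat_recr //= IHN; case: (boolP (odd N)) => oN; case: (leqP u N) => leuN;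
  case: (ltnP N v) => ltNv /=; lia.
Qed.

Lemma half_subD u v : (u <= v)%N ->
  ((uphalf v - uphalf u) + (v./2 - u./2) = v - u)%N.
Proof.
move=> le_uv; have := uphalf_leq le_uv; have := half_leq le_uv.
have hD w : w = (uphalf w + w./2)%N by rewrite uphalf_half -addnA addnn odd_double_half.
by rewrite [in RHS](hD u) [in RHS](hD v); move: (uphalf _) (uphalf _) (half _) (half _); lia.
Qed.

(** Parities alternate, so the even minus the odd numbers in [u, v) depend only on the parities of
    the ends. *)
Lemma half_subB u v : (u <= v)%N ->
  (uphalf v - uphalf u)%N%:Z - (v./2 - u./2)%N%:Z = (odd v)%:Z - (odd u)%:Z.
Proof.
move=> le_uv; have := uphalf_leq le_uv; have := half_leq le_uv.
rewrite !uphalf_half; move: (odd u) (odd v) (half u) (half v); lia.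
Qed.

Section TypeCounts.
Variables k m j : nat.
Hypotheses (le_mk : (m <= k)%N) (le_j : (2 * j <= 3 * (k - m))%N).

(* The admissible i are those with lo <= i < hi. Up to transposition, the type
   is T_a or T_d for i < mid and T_b or T_c for i >= mid, according to the
   parity of i. *)
Let lo := (j - (k - m))%N.
Let mid := ((j %/ 3).+1 - (j %% 3 == 1%N))%N.
Let hi := minn j.+1 (2 * (k - m) - j).+1.

Let base_count (T : tableau) : nat :=
  \sum_(0 <= i < j.+1) (kkk_cond k m j i && (two_row_type_of_counts i (j - i) == T)).

Lemma type_countE T : T \in [:: T_a; T_b; T_c; T_d] ->
  type_count k m j T = base_count (if odd m then transpose T else T).
Proof.
move=> hT; apply: eq_bigr => i _; rewrite iter_transpose //.
by rewrite /two_row_type_of_counts; case: ifP => _; case: ifP.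
Qed.

Let order : (lo <= mid)%N /\ (mid <= hi)%N /\ (hi <= j.+1)%N.
Proof. rewrite /lo /mid /hi; lia. Qed.

Let inside i : (i < j.+1)%N -> kkk_cond k m j i = (lo <= i < hi)%N.
Proof. rewrite /kkk_cond /lo /hi; lia. Qed.

(** The condition reads 3i <= j and j <> 3i + 1; the exception removes i = j %/ 3 exactly when j is
    1 mod 3. *)
Let good i : (i < j.+1)%N ->
  ((2 * i <= j - i) && (j - i != 2 * i + 1))%N = (i < mid)%N.
Proof. rewrite /mid; lia. Qed.

Lemma base_count_a : base_count T_a = (uphalf mid - uphalf lo)%N.
Proof.
have [? [? ?]] := order; rewrite -(@sum_even_interval j.+1); last lia.
apply: eq_big_nat => i /andP[_ lti]; rewrite inside // /two_row_type_of_counts good //.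
by case: (ltnP i mid); case: (odd i) => /= ?; rewrite ?andbF ?andbT //; congr nat_of_bool; lia.
Qed.
Lemma base_count_d : base_count T_d = (mid./2 - lo./2)%N.
Proof.
have [? [? ?]] := order; rewrite -(@sum_odd_interval j.+1); last lia.
apply: eq_big_nat => i /andP[_ lti]; rewrite inside // /two_row_type_of_counts good //.
by case: (ltnP i mid); case: (odd i) => /= ?; rewrite ?andbF ?andbT //; congr nat_of_bool; lia.
Qed.
Lemma base_count_b : base_count T_b = (uphalf hi - uphalf mid)%N.
Proof.
have [? [? ?]] := order; rewrite -(@sum_even_interval j.+1); last lia.
apply: eq_big_nat => i /andP[_ lti]; rewrite inside // /two_row_type_of_counts good //.
by case: (ltnP i mid); case: (odd i) => /= ?; rewrite ?andbF ?andbT //; congr nat_of_bool; lia.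
Qed.
Lemma base_count_c : base_count T_c = (hi./2 - mid./2)%N.
Proof.
have [? [? ?]] := order; rewrite -(@sum_odd_interval j.+1); last lia.
apply: eq_big_nat => i /andP[_ lti]; rewrite inside // /two_row_type_of_counts good //.
by case: (ltnP i mid); case: (odd i) => /= ?; rewrite ?andbF ?andbT //; congr nat_of_bool; lia.
Qed.

(** Thanks to the exception N_3 = 2 N_2 + 1, [mid] has the same parity as [hi], so [mid, hi)
    contains as many even as odd numbers: T_b and T_c occur equally often. *)
Let odd_mid : odd mid = ~~ odd j.
Proof. rewrite /mid; lia. Qed.

Let odd_hi : odd hi = ~~ odd j.
Proof. rewrite /hi /minn; case: ifP; lia. Qed.

Let size_interval : (hi - lo = minn j.+1 (3 * (k - m) + 1 - 2 * j))%N.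
Proof.
rewrite /hi /lo; move: le_j; clear; move: (k - m)%N => k' le_j.
by rewrite /minn; case: ifP => ?; case: ifP => ?; lia.
Qed.

(** 2 lo + hi = j + 1, whichever term attains the minimum in [hi]. *)
Let good_excess : 3 * mid%:Z - 2 * lo%:Z - hi%:Z = 3 * mid%:Z - j%:Z - 1.
Proof.
rewrite /hi /lo; move: mid le_j; clear; move: (k - m)%N => k' m' le_j.
by rewrite /minn; case: ifP => ?; lia.
Qed.

(** For odd [m], transposition exchanges T_a with T_d and T_b with T_c. The abstract [f] allows any
    statement about the four counts to be rewritten at once. *)
Let swap_counts (V : Type) (f : nat -> nat -> nat -> nat -> V) :
  f (type_count k m j T_a) (type_count k m j T_b)
    (type_count k m j T_c) (type_count k m j T_d) =
  let a := (uphalf mid - uphalf lo)%N in let b := (uphalf hi - uphalf mid)%N in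
  let c := (hi./2 - mid./2)%N in let d := (mid./2 - lo./2)%N in
  if odd m then f d c b a else f a b c d.
Proof.
rewrite !type_countE // -base_count_a -base_count_b -base_count_c -base_count_d.
by case: (odd m).
Qed.

Lemma type_count_total :
  (type_count k m j T_a + type_count k m j T_b + type_count k m j T_c
   + type_count k m j T_d = minn j.+1 (3 * (k - m) + 1 - 2 * j))%N.
Proof.
have [le1 [le2 _]] := order; rewrite (swap_counts (fun a b c d => a + b + c + d)%N).
rewrite -size_interval /=; have := half_subD le1; have := half_subD le2.
by case: ifP => _; move: (uphalf hi - uphalf mid)%N (hi./2 - mid./2)%N (uphalf mid - uphalf lo)%N (mid./2 - lo./2)%N;
    move: lo mid hi le1 le2; clear; lia.
Qed.

Lemma type_count_bc : type_count k m j T_b = type_count k m j T_c.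
Proof.
have [_ [le2 _]] := order; apply/eqP; rewrite (swap_counts (fun a b c d => b == c)) /=.
have := half_subB le2; rewrite odd_hi odd_mid subrr => /eqP; rewrite subr_eq0 eqz_nat => /eqP->.
by rewrite eqxx if_same.
Qed.

Lemma type_count_ad : (type_count k m j T_a)%:Z - (type_count k m j T_d)%:Z =
  if odd (minn j.+1 (3 * (k - m) + 1 - 2 * j)) then if odd (j + m) then -1 else 1 else 0.
Proof.
have [le1 [le2 _]] := order; rewrite (swap_counts (fun a b c d => a%:Z - d%:Z)) /=.
rewrite -size_interval oddD oddB ?(leq_trans le1) // odd_hi.
rewrite -[X in if _ then X else _]opprB (half_subB le1) odd_mid.
by case: (odd m); case: (odd j); case: (odd lo).
Qed.

Lemma type_count_ad_bc :
  2 * ((type_count k m j T_a)%:Z + (type_count k m j T_d)%:Z)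
  - ((type_count k m j T_b)%:Z + (type_count k m j T_c)%:Z) =
  if (j %% 3 == 0)%N then 2 else if (j %% 3 == 1)%N then -2 else 0.
Proof.
have [le1 [le2 _]] := order.
rewrite (swap_counts (fun a b c d => 2 * (a%:Z + d%:Z) - (b%:Z + c%:Z))) /=.
(* Types T_a and T_d together fill [lo, mid), types T_b and T_c fill [mid, hi). *)
transitivity (3 * mid%:Z - 2 * lo%:Z - hi%:Z).
  have := half_subD le1; have := half_subD le2.
  by case: ifP => _; move: (uphalf hi - uphalf mid)%N (hi./2 - mid./2)%N (uphalf mid - uphalf lo)%N (mid./2 - lo./2)%N;
    move: lo mid hi le1 le2; clear; lia.
rewrite good_excess /mid; move: (divn_eq j 3) (@ltn_pmod j 3 isT); clear.
by move: (j %/ 3)%N (j %% 3)%N => q [|[|[|//]]] -> _ /=; lia.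
Qed.

End TypeCounts.

Section TypeCoefs.
Variables k b1 b2 b3 : nat.
Hypotheses (sum_b : (b1 + b2 + b3 = 3 * k + 3)%N) (lt_b : (b3 < b2 < b1)%N).
Let j := (b2 - b3 - 1)%N.

Let le3 : (b3 <= k)%N. Proof. lia. Qed.
Let lej : (2 * j <= 3 * (k - b3))%N. Proof. rewrite /j; lia. Qed.
(** The two terms of the minimum are b2 - b3 and, by the value of the total, b1 - b2. *)
Let gapE : minn j.+1 (3 * (k - b3) + 1 - 2 * j) = min_gap b1 b2 b3.
Proof. rewrite /min_gap /j; lia. Qed.

Lemma type_count_kostka :
  ((type_count k b3 j T_a + type_count k b3 j T_b + type_count k b3 j T_c
    + type_count k b3 j T_d)%N)%:Z = kostka_coef b1 b2 b3.
Proof. by rewrite type_count_total // gapE /kostka_coef /alternating_extension lt_b. Qed.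

Lemma type_count_sign :
  (type_count k b3 j T_a)%:Z - (type_count k b3 j T_d)%:Z = sign_coef b1 b2 b3.
Proof.
rewrite type_count_ad // gapE /sign_coef /alternating_extension lt_b.
have -> : odd (j + b3) = ~~ odd b2 by rewrite /j; lia.
by case: (odd b2).
Qed.

(** As 3 divides b1 + b2 + b3, the gaps b1 - b2 and b2 - b3 = j + 1 agree mod 3, so j mod 3
    determines the sign. *)
Lemma type_count_sgn_mod3 :
  2 * ((type_count k b3 j T_a)%:Z + (type_count k b3 j T_d)%:Z)
  - ((type_count k b3 j T_b)%:Z + (type_count k b3 j T_c)%:Z) = 2 * sgn_mod3 b1 b2 b3.
Proof.
rewrite type_count_ad_bc //.
rewrite /sgn_mod3; move: (divn_eq j 3) (@ltn_pmod j 3 isT); rewrite /j.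
move: (_ %/ 3)%N (_ %% 3)%N sum_b lt_b; clear; move=> q r sum_b lt_b jE.
case: r jE => [|[|[|//]]] jE _ /=.
- have -> : (b1 == b2.+1 %[mod 3]) = true by lia.
  have -> : (b2 == b3.+1 %[mod 3]) = true by lia.
  by have -> : (b2 == b1.+1 %[mod 3]) = false by lia.
- have -> : (b1 == b2.+1 %[mod 3]) = false by lia.
  have -> : (b2 == b1.+1 %[mod 3]) = true by lia.
  by have -> : (b3 == b2.+1 %[mod 3]) = true by lia.
- have -> : (b1 == b2.+1 %[mod 3]) = false by lia.
  by have -> : (b2 == b1.+1 %[mod 3]) = false by lia.
Qed.
End TypeCoefs.

(** * Plethysm computed from any expression in power sums *)

Lemma comp_mpolyA (R : comNzRingType) d N n (P : {mpoly R[d]})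
    (A : d.-tuple {mpoly R[N]}) (Y : N.-tuple {mpoly R[n]}) :
  comp_mpoly Y (comp_mpoly A P) = comp_mpoly [tuple comp_mpoly Y (tnth A i) | i < d] P.
Proof.
rewrite [comp_mpoly A P]comp_mpolyEX [RHS]comp_mpolyEX rmorph_sum; apply: eq_bigr => m _.
rewrite !comp_mpolyX [LHS]linearZ /=; congr (_ *: _).
by rewrite rmorph_prod; apply: eq_bigr => i _; rewrite rmorphXn tnth_mktuple.
Qed.

(* If g is the sum of the monomials [M i], then f[g] is f evaluated at these
   monomials; this is why the polynomial chosen in [plethysm] does not matter. *)
Lemma symfun_eval_unique n (I : finType) (A : {pred I})
    (M : I -> {mpoly rat[n]}) (h : nat -> symfun) d1 d2 (P1 : {mpoly rat[d1]}) (P2 : {mpoly rat[d2]}) :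
  (forall m, h m n = \sum_(i in A) M i ^+ m) ->
  (forall N, symfun_eval P1 psum N = symfun_eval P2 psum N) ->
  symfun_eval P1 h n = symfun_eval P2 h n.
Proof.
move=> hE P12; pose Y := [tuple M (enum_val i) | i < #|A|].
(* Substituting the [M i] turns the power sums in #|A| variables into the [h m n], so the evaluation
   factors through the evaluation at power sums. *)
have evalE d (P : {mpoly rat[d]}) : symfun_eval P h n = comp_mpoly Y (symfun_eval P psum #|A|).
  rewrite /symfun_eval comp_mpolyA; congr (comp_mpoly _ P).
  apply: eq_from_tnth => i; rewrite !tnth_mktuple hE /psum rmorph_sum big_enum_val.
  by apply: eq_bigr => j _; rewrite rmorphXn /= comp_mpolyXU -tnth_nth tnth_mktuple.
by rewrite !evalE P12.
Qed.

(** [epsilon] returns some polynomial expressing [f] in power sums, and [symfun_eval_unique] applies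
    because a Schur function is a sum of monomials indexed by tableaux. *)
Lemma plethysmE (f : symfun) la d (P : {mpoly rat[d]}) n :
  (forall N, f N = symfun_eval P psum N) ->
  plethysm f (schur la) n = symfun_eval P (fun m => psum_plethysm m (schur la)) n.
Proof.
move=> fP; rewrite /plethysm.
pose good (dP : {d : nat & {mpoly rat[d]}}) := forall n, f n = symfun_eval (projT2 dP) psum n.
rewrite -/good; have : good (epsilon (inhabits (existT (fun d => {mpoly rat[d]}) 0%N 0)) good).
  by apply: epsilon_spec; exists (existT (fun d => {mpoly rat[d]}) d P).
move: (epsilon _ _) => [d' P'] /= fP'.
pose M (U : filling n (sumn la)) : {mpoly rat[n]} :=
  \prod_(r <- U) \prod_(i <- (r : (sumn la).-bseq 'I_n)) 'X_i.
apply: (@symfun_eval_unique n _ (SSYT n la) M) => [m | N]; last by rewrite -fP fP'.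
rewrite /psum_plethysm /schur rmorph_sum; apply: eq_bigr => U _ /=.
rewrite rmorph_prod /M -prodrXl; apply: eq_bigr => r _ /=.
rewrite rmorph_prod -prodrXl; apply: eq_bigr => i _ /=.
by rewrite comp_mpolyXU -tnth_nth tnth_mktuple.
Qed.

(** * Newton's identities and the power-sum expansions of the Schur functions of degree 3 *)

Section Newton.
Variables (R : comNzRingType) (y : nat -> R).

Definition power_sum (m n : nat) : R := \sum_(i < n) y i.+1 ^+ m.

Lemma power_sumS m n : power_sum m n.+1 = power_sum m n + y n.+1 ^+ m.
Proof. exact: big_ord_recr. Qed.

Lemma complete_newton n :
  [/\ complete y n 1 = power_sum 1 n,
      2%:R * complete y n 2 = power_sum 1 n ^+ 2 + power_sum 2 n &
      6%:R * complete y n 3 = power_sum 1 n ^+ 3 + 3%:R * power_sum 1 n * power_sum 2 n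
                              + 2%:R * power_sum 3 n].
Proof.
elim: n => [|n [IH1 IH2 IH3]]; first by rewrite /power_sum !big_ord0; split; rewrite /complete /=; ring.
have e1 : complete y n.+1 1 = power_sum 1 n.+1.
  by rewrite completeS complete0 IH1 power_sumS; ring.
have e2 : 2%:R * complete y n.+1 2 = power_sum 1 n.+1 ^+ 2 + power_sum 2 n.+1.
  by rewrite completeS e1 mulrDr IH2 !power_sumS; ring.
split=> //; rewrite completeS mulrDr IH3.
have -> : 6%:R * (y n.+1 * complete y n.+1 2) = 3%:R * y n.+1 * (2%:R * complete y n.+1 2) by ring.
by rewrite e2 !power_sumS; ring.
Qed.

End Newton.

Lemma complete_rmorph (R S : comNzRingType) (phi : {rmorphism R -> S}) (y : nat -> R) n m :
  phi (complete y n m) = complete (fun i => phi (y i)) n m.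
Proof.
elim: n m => [|n IHn] m; first by rewrite /complete rmorph_nat.
elim: m => [|m IHm]; first exact: IHn.
by rewrite !completeS rmorphD rmorphM IHn IHm.
Qed.

Lemma eq_complete (R : comNzRingType) (y z : nat -> R) n m : y =1 z ->
  complete y n m = complete z n m.
Proof.
move=> yz; elim: n m => [//|n IHn]; elim=> [|m IHm]; first exact: IHn.
by rewrite !completeS IHn IHm yz.
Qed.

Lemma schur_row n k : (0 < k)%N -> schur [:: k] n = complete (mpoly_var n) n k.
Proof.
case: k => // k _; rewrite (@schur_jacobi_trudi n k.+1 0 0) //.
by rewrite /jacobi_trudi /scomplete complete0; ring.
Qed.

Lemma psum_plethysm_schur_row n k m : (0 < k)%N -> (0 < m)%N ->
  psum_plethysm m (schur [:: k]) n = complete (fun i => mpoly_var n i ^+ m) n k.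
Proof.
move=> k_gt0 m_gt0; rewrite /psum_plethysm schur_row // complete_rmorph.
(* Outside 1..n the sequence [mpoly_var n] is 0, and so are its m-th powers because m > 0. *)
apply: eq_complete => -[|i] /=; first by rewrite rmorph0 expr0n gtn_eqF.
case: insubP => [j _ _|_] /=; last by rewrite rmorph0 expr0n gtn_eqF.
by rewrite comp_mpolyXU -tnth_nth tnth_mktuple.
Qed.

Lemma psum_power_sum m n : psum m n = power_sum (mpoly_var n) m n.
Proof. by apply: eq_bigr => i _; rewrite mpoly_varS. Qed.

(** ['X_0], ['X_1], ['X_2] stand for p_1, p_2, p_3; all three expansions are put over the
    denominator 6. *)
Definition newton_3 : {mpoly rat[3]} :=
  (6%:R^-1 : rat) *: ('X_0 ^+ 3 + 3%:R * 'X_0 * 'X_1 + 2%:R * 'X_2).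
Definition newton_21 : {mpoly rat[3]} := (6%:R^-1 : rat) *: (2%:R * 'X_0 ^+ 3 - 2%:R * 'X_2).
Definition newton_111 : {mpoly rat[3]} :=
  (6%:R^-1 : rat) *: ('X_0 ^+ 3 - 3%:R * 'X_0 * 'X_1 + 2%:R * 'X_2).

Lemma symfun_eval_var (i : 'I_3) h n :
  comp_mpoly [tuple (h : nat -> symfun) (i : 'I_3).+1 n | i < 3] 'X_i = h i.+1 n.
Proof. by rewrite comp_mpolyXU -tnth_nth tnth_mktuple. Qed.

Lemma symfun_eval_newton_3 h n : symfun_eval newton_3 h n =
  (6%:R^-1 : rat) *: (h 1%N n ^+ 3 + 3%:R * h 1%N n * h 2%N n + 2%:R * h 3%N n).
Proof.
rewrite /symfun_eval /newton_3 comp_mpolyZ !rmorphD rmorphXn !rmorphM !rmorph_nat /=.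
by rewrite !symfun_eval_var.
Qed.

Lemma symfun_eval_newton_21 h n : symfun_eval newton_21 h n =
  (6%:R^-1 : rat) *: (2%:R * h 1%N n ^+ 3 - 2%:R * h 3%N n).
Proof.
rewrite /symfun_eval /newton_21 comp_mpolyZ !mulr_natl rmorphB !rmorphMn rmorphXn /=.
by rewrite !symfun_eval_var.
Qed.

Lemma symfun_eval_newton_111 h n : symfun_eval newton_111 h n =
  (6%:R^-1 : rat) *: (h 1%N n ^+ 3 - 3%:R * h 1%N n * h 2%N n + 2%:R * h 3%N n).
Proof.
rewrite /symfun_eval /newton_111 comp_mpolyZ !rmorphD rmorphN rmorphXn !rmorphM !rmorph_nat /=.
by rewrite !symfun_eval_var.
Qed.

Lemma scale_natV (n c : nat) (p q : {mpoly rat[n]}) : (0 < c)%N ->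
  c%:R * p = q -> p = (c%:R^-1 : rat) *: q.
Proof.
move=> c_gt0 <-; rewrite mulr_natl -scaler_nat scalerA mulVf ?scale1r //.
by rewrite Num.Theory.pnatr_eq0 -lt0n.
Qed.

Lemma schur_3 N : schur (shape T_a) N = symfun_eval newton_3 psum N.
Proof.
have [_ _ e3] := complete_newton (mpoly_var N) N.
rewrite symfun_eval_newton_3 !psum_power_sum; apply: scale_natV => //.
by rewrite -e3 schur_row.
Qed.

Lemma schur_21 N : schur (shape T_b) N = symfun_eval newton_21 psum N.
Proof.
have [e1 e2 e3] := complete_newton (mpoly_var N) N.
rewrite symfun_eval_newton_21 !psum_power_sum; apply: scale_natV => //.
rewrite (@schur_jacobi_trudi N 2 1 0) // /jacobi_trudi /scomplete complete0.
set h1 := complete _ _ 1 in e1 e2 e3 *; set h2 := complete _ _ 2 in e1 e2 e3 *.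
set h3 := complete _ _ 3 in e1 e2 e3 *.
(* s_(2,1) = h_1 h_2 - h_3, multiplied by 6 and grouped into the multiples given by
   [complete_newton]. *)
transitivity (3%:R * h1 * (2%:R * h2) - 6%:R * h3); first by ring.
by rewrite e2 e3 e1; ring.
Qed.

Lemma schur_111 N : schur (shape T_d) N = symfun_eval newton_111 psum N.
Proof.
have [e1 e2 e3] := complete_newton (mpoly_var N) N.
rewrite symfun_eval_newton_111 !psum_power_sum; apply: scale_natV => //.
rewrite (@schur_jacobi_trudi N 1 1 1) // /jacobi_trudi /scomplete complete0.
set h1 := complete _ _ 1 in e1 e2 e3 *; set h2 := complete _ _ 2 in e1 e2 e3 *.
set h3 := complete _ _ 3 in e1 e2 e3 *.
transitivity (6%:R * h1 ^+ 3 - 6%:R * h1 * (2%:R * h2) + 6%:R * h3); first by ring.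
by rewrite e2 e3 e1; ring.
Qed.

(** * The linear relations between the four right-hand sides and their solution *)

Lemma sum_SSYTkkk_schur n k T :
  \sum_(S in SSYTkkk k | type_of k (tableau_of S) == T)
     schur (shape (tableau_of S)) n =
  jacobi_trudi_sum (mpoly_var n) n k (3 * k + 4)
    (fun b1 b2 b3 => (type_count k b3 (b2 - b3 - 1) T)%:Z).
Proof.
rewrite (@sum_SSYTkkk _ (fun la => schur la n) k (3 * k + 4)); last by rewrite ltn_add2l.
apply: eq_triple_sum => b1 b2 b3 sum_b; case: ifP => // /andP[lt32 lt21].
rewrite schur_jacobi_trudi; last lia.
have -> : ((b1 - 2).+2 = b1)%N by lia.
by have -> : ((b2 - 1).+1 = b2)%N by [lia]; rewrite -mulr_natl.
Qed.

Lemma jacobi_trudi_sumD (R : idomainType) (y : nat -> R) n k B c1 c2 :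
  jacobi_trudi_sum y n k B (fun a b d => c1 a b d + c2 a b d) =
  jacobi_trudi_sum y n k B c1 + jacobi_trudi_sum y n k B c2.
Proof.
rewrite -triple_sumD; apply: eq_triple_sum => a b d _.
by case: ifP; rewrite ?addr0 // rmorphD mulrDl.
Qed.

Lemma jacobi_trudi_sumZ (R : idomainType) (y : nat -> R) n k B z c :
  jacobi_trudi_sum y n k B (fun a b d => z * c a b d) =
  z%:~R * jacobi_trudi_sum y n k B c.
Proof.
rewrite -triple_sumZ; apply: eq_triple_sum => a b d _.
by case: ifP; rewrite ?mulr0 // rmorphM mulrA.
Qed.

Lemma eq_jacobi_trudi_sum (R : idomainType) (y : nat -> R) n k B c1 c2 :
  (forall b1 b2 b3, (b1 + b2 + b3 = 3 * k + 3)%N -> (b3 < b2 < b1)%N ->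
     c1 b1 b2 b3 = c2 b1 b2 b3) ->
  jacobi_trudi_sum y n k B c1 = jacobi_trudi_sum y n k B c2.
Proof.
move=> c12; apply: eq_triple_sum => a b d sum_b; case: ifP => // lt_b.
by rewrite c12.
Qed.

Section TypeSums.
Variables n k : nat.
Hypothesis k_gt0 : (0 < k)%N.
Let H m := psum_plethysm m (schur [:: k]) n.
Let Sch T :=
  \sum_(S in SSYTkkk k | type_of k (tableau_of S) == T) schur (shape (tableau_of S)) n.

Let nz6 : 6%:R != 0 :> {mpoly rat[n]}.
Proof. by rewrite -(rmorph_nat (@mpolyC n rat)) mpolyC_eq0. Qed.

Let HE m : (0 < m)%N -> H m = complete (fun i => mpoly_var n i ^+ m) n k.
Proof. exact: psum_plethysm_schur_row. Qed.

Let H1E : H 1 = complete (mpoly_var n) n k.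
Proof. by rewrite HE //; apply: eq_complete => i; rewrite expr1. Qed.

Let ltB : (3 * k + 3 < 3 * k + 4)%N.
Proof. by rewrite ltn_add2l. Qed.

Lemma type_sums_total : Sch T_a + Sch T_b + Sch T_c + Sch T_d = H 1 ^+ 3.
Proof.
rewrite /Sch !sum_SSYTkkk_schur -!jacobi_trudi_sumD H1E.
rewrite -(jacobi_trudi_sum_kostka (mpoly_var n) n nz6 ltB).
apply: eq_jacobi_trudi_sum => b1 b2 b3 sum_b lt_b.
by rewrite -(type_count_kostka sum_b lt_b) !PoszD.
Qed.

Lemma type_sums_bc : Sch T_b = Sch T_c.
Proof.
rewrite /Sch !sum_SSYTkkk_schur; apply: eq_jacobi_trudi_sum => b1 b2 b3 sum_b lt_b.
by rewrite type_count_bc //; clear -sum_b lt_b; lia.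
Qed.

Lemma type_sums_ad : Sch T_a - Sch T_d = H 1 * H 2.
Proof.
rewrite /Sch !sum_SSYTkkk_schur H1E HE // -(jacobi_trudi_sum_sign (mpoly_var n) n nz6 ltB).
rewrite -[X in _ + X]mulN1r -(jacobi_trudi_sumZ _ _ _ _ (-1)) -jacobi_trudi_sumD.
apply: eq_jacobi_trudi_sum => b1 b2 b3 sum_b lt_b.
by rewrite -(type_count_sign sum_b lt_b) mulN1r.
Qed.

Lemma type_sums_ad_bc :
  2%:R * (Sch T_a + Sch T_d) - (Sch T_b + Sch T_c) = 2%:R * H 3.
Proof.
rewrite /Sch !sum_SSYTkkk_schur HE // -(jacobi_trudi_sum_sgn_mod3 (mpoly_var n) n ltB).
rewrite -[X in _ + X]mulN1r -!jacobi_trudi_sumD.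
rewrite -(jacobi_trudi_sumZ _ _ _ _ (-1)) -!(jacobi_trudi_sumZ _ _ _ _ 2) -jacobi_trudi_sumD.
apply: eq_jacobi_trudi_sum => b1 b2 b3 sum_b lt_b.
by rewrite -(type_count_sgn_mod3 sum_b lt_b) mulN1r.
Qed.

End TypeSums.

Theorem theorem5p3 (k : nat) (hk : (1 <= k)%N) (T : tableau)
    (hT : T \in [:: T_a; T_b; T_c; T_d]) (n : nat) :
  plethysm (schur (shape T)) (schur [:: k]) n =
  \sum_(S in SSYTkkk k | type_of k (tableau_of S) == T)
     schur (shape (tableau_of S)) n.
Proof.
have tot := type_sums_total n hk; have bc := type_sums_bc n k.
have ad := type_sums_ad n hk; have abcd := type_sums_ad_bc n hk.
rewrite -bc in tot abcd.
move: hT; rewrite !inE => /or4P[]/eqP->.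
(* With C = B, 6A = (A + 2B + D) + 3 (A - D) + (2 (A + D) - 2B); the other cases solve the same
   linear system for B and D. *)
- rewrite (plethysmE _ _ schur_3) symfun_eval_newton_3; apply/esym/scale_natV => //.
  by rewrite -tot -mulrA -ad -abcd; ring.
- rewrite (plethysmE _ _ schur_21) symfun_eval_newton_21; apply/esym/scale_natV => //.
  by rewrite -tot -abcd; ring.
(* T_c has the same shape as T_b, so the equality of their sums reduces this case to the previous
   one. *)
- rewrite -bc (plethysmE _ _ schur_21) symfun_eval_newton_21; apply/esym/scale_natV => //.
  by rewrite -tot -abcd; ring.
- rewrite (plethysmE _ _ schur_111) symfun_eval_newton_111; apply/esym/scale_natV => //.
  by rewrite -tot -mulrA -ad -abcd; ring.
Qed.
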